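(* Let $h\colon[n]\to[n]$ be a Hessenberg function, let $\lambda_1<\cdots<\lambda_n$ be real numbers and $\Lambda=\operatorname{diag}(\lambda_1,\ldots,\lambda_n)$. There exists a smooth submanifold $Z_h\subseteq U(n)$, invariant under both the left and the right multiplication actions of $T^n$ on $U(n)$, such that its left quotient $T^n\backslash Z_h\subseteq T^n\backslash U(n)$ is $X_h$ and its right quotient $Z_h/T^n\subseteq U(n)/T^n$ is $Y_h$ (under the identifications $T^n\backslash U(n)\cong M_\lambda$ and $U(n)/T^n\cong \mathrm{Fl}_n$ described in the context).
   Context: $[n]=\{1,\ldots,n\}$. A Hessenberg function is a function $h\colon[n]\to[n]$ with $h(i)\ge i$ for all $i$ and $h(i+1)\ge h(i)$ for $1\le i\le n-1$. $U(n)$ is the unitary group and $T^n\subset U(n)$ is the subgroup of diagonal unitary matrices; it acts freely on $U(n)$ by left multiplication and by right multiplication. $M_h$ is the real vector space of Hermitian $n\times n$ matrices $A=(a_{ij})$ with $a_{ij}=0$ whenever $j>h(i)$ or $i>h(j)$. $M_\lambda$ is the set of all Hermitian $n\times n$ matrices with spectrum $\{\lambda_1,\ldots,\lambda_n\}$. The space of isospectral staircase matrices is $X_h=M_h\cap M_\lambda$. $\mathrm{Fl}_n$ is the variety of complete flags $V_\bullet=(V_0\subset V_1\subset\cdots\subset V_n)$ in $\mathbb{C}^n$, $\dim V_i=i$. The semisimple Hessenberg variety is $Y_h=\{V_\bullet\in\mathrm{Fl}_n\mid \Lambda V_i\subseteq V_{h(i)}\text{ for all } i\}$. Identifications: $T^n\backslash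 U(n)\cong M_\lambda$ sends the class of $U$ to $U^{-1}\Lambda U$; $U(n)/T^n\cong\mathrm{Fl}_n$ sends the class of $U$ to the flag whose $i$-th subspace is spanned by the first $i$ columns of $U$. *)

(* Defs.v *)
From HB Require Import structures.
From mathcomp Require Import all_boot all_order all_algebra.
From mathcomp Require Import all_classical all_reals.
From mathcomp Require Import topology normedtype derive.
From mathcomp Require Import complex.

Set Implicit Arguments.
Unset Strict Implicit.
Unset Printing Implicit Defensive.

Import Order.TTheory GRing.Theory Num.Theory.
Import numFieldNormedType.Exports.

Local Open Scope classical_set_scope.
Local Open Scope ring_scope.
Local Open Scope sesquilinear_scope.

(* Used below for finite-dimensional V and W only, where this is the usual
   notion of a C^k map on an open set O. *)
Fixpoint Ck (R : realType) (V W : normedModType R) (k : nat)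
    (O : set V) (f : V -> W) : Prop :=
  match k with
  | 0%N => forall x, O x -> {for x, continuous f}
  | k'.+1 => (forall x, O x -> differentiable f x) /\
             (forall v : V, Ck k' O (fun x => 'D_v f x))
  end.

(* Smoothness on an arbitrary subset A: local smooth extendability to open
   subsets of the ambient space. *)
Definition smooth_on (R : realType) (V W : normedModType R)
    (A : set V) (f : V -> W) : Prop :=
  forall x, A x -> exists (O : set V) (g : V -> W),
    [/\ open O, O x, (forall k, Ck k O g) & {in A `&` O, f =1 g}].

(* A diffeomorphism phi, with inverse psi, from the relatively open subset
   M `&` O of M onto the open subset D of R^d. *)
Definition smooth_chart (R : realType) (V : normedModType R) (M : set V)
    (d : nat) (O : set V) (D : set 'rV[R]_d)
    (phi : V -> 'rV[R]_d) (psi : 'rV[R]_d -> V) : Prop :=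
  [/\ open O /\ open D,
      (forall p, (M `&` O) p -> D (phi p) /\ psi (phi p) = p),
      (forall x, D x -> (M `&` O) (psi x) /\ phi (psi x) = x),
      smooth_on (M `&` O) phi & smooth_on D psi].

(* The linear subspace R^k x 0 of R^d. *)
Definition coord_subspace (R : realType) (d k : nat) : set 'rV[R]_d :=
  [set x | forall i : 'I_d, (k <= i)%N -> x ord0 i = 0].

(* Z is a smooth (embedded) submanifold of M, where M carries the smooth
   structure induced by the ambient space V: around each point of Z there is a
   chart of M in which Z is a coordinate subspace. *)
Definition smooth_submanifold (R : realType) (V : normedModType R)
    (M Z : set V) : Prop :=
  Z `<=` M /\
  exists d k : nat, (k <= d)%N /\
    forall p, Z p -> exists O D phi psi,
      [/\ O p, @smooth_chart R V M d O D phi psi &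
          phi @` (Z `&` O) = D `&` @coord_subspace R d k].

(* 'M[R[i]]_n has no real normed-module structure in the library, so it is
   identified with the real vector space of pairs of real matrices. *)
Definition realify (R : realType) (n : nat) (A : 'M[R[i]]_n) :
    ('M[R]_n * 'M[R]_n)%type :=
  (map_mx (@complex.Re R) A, map_mx (@complex.Im R) A).

Definition smooth_mx_submanifold (R : realType) (n : nat)
    (M Z : set 'M[R[i]]_n) : Prop :=
  smooth_submanifold (realify (n:=n) @` M) (realify (n:=n) @` Z).

Definition unitary_group (R : realType) (n : nat) : set 'M[R[i]]_n :=
  [set U | U \is unitarymx].

Definition diag_torus (R : realType) (n : nat) : set 'M[R[i]]_n :=
  [set t | is_diag_mx t /\ t \is unitarymx].

(* The index i : 'I_n stands for the element i.+1 of [n] = {1, ..., n}. *)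
Definition hessenberg_function (n : nat) (h : 'I_n -> 'I_n) : Prop :=
  (forall i : 'I_n, (i <= h i)%N) /\
  (forall i j : 'I_n, j = i.+1 :> nat -> (h i <= h j)%N).

Definition Lambda_mx (R : realType) (n : nat) (lam : 'I_n -> R) : 'M[R[i]]_n :=
  diag_mx (\row_j ((lam j)%:C)%C).

Definition hermitian_staircase (R : realType) (n : nat) (h : 'I_n -> 'I_n) :
    set 'M[R[i]]_n :=
  [set A | A \is hermsymmx /\
           forall i j : 'I_n, (h i < j)%N || (h j < i)%N -> A i j = 0].

Definition isospectral (R : realType) (n : nat) (lam : 'I_n -> R) :
    set 'M[R[i]]_n :=
  [set A | A \is hermsymmx /\
           forall a : R[i], eigenvalue A a <-> exists j, a = ((lam j)%:C)%C].

Definition isospectral_staircase (R : realType) (n : nat)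
    (h : 'I_n -> 'I_n) (lam : 'I_n -> R) : set 'M[R[i]]_n :=
  hermitian_staircase h `&` isospectral lam.

Definition flag_type (R : realType) (n : nat) : choiceType :=
  {ffun 'I_n.+1 -> {vspace 'cV[R[i]]_n}}.

Definition complete_flags (R : realType) (n : nat) : set (flag_type R n) :=
  [set V | (forall i j : 'I_n.+1, (i <= j)%N -> (V i <= V j)%VS) /\
           (forall i : 'I_n.+1, \dim (V i) = i)].

(* lift ord0 i : 'I_n.+1 has value i.+1, so V (lift ord0 i) is the term of the
   flag of dimension i.+1. *)
Definition hessenberg_variety (R : realType) (n : nat)
    (h : 'I_n -> 'I_n) (lam : 'I_n -> R) : set (flag_type R n) :=
  [set V | @complete_flags R n V /\
           forall (i : 'I_n) (v : 'cV[R[i]]_n), v \in V (lift ord0 i) ->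
             Lambda_mx lam *m v \in V (lift ord0 (h i))].

Definition left_class (R : realType) (n : nat) (U : 'M[R[i]]_n) :
    set 'M[R[i]]_n := [set t *m U | t in @diag_torus R n].

Definition right_class (R : realType) (n : nat) (U : 'M[R[i]]_n) :
    set 'M[R[i]]_n := [set U *m t | t in @diag_torus R n].

Definition left_quotient (R : realType) (n : nat) (Z : set 'M[R[i]]_n) :
    set (set 'M[R[i]]_n) := [set left_class U | U in Z].

Definition right_quotient (R : realType) (n : nat) (Z : set 'M[R[i]]_n) :
    set (set 'M[R[i]]_n) := [set right_class U | U in Z].

Definition column_flag (R : realType) (n : nat) (U : 'M[R[i]]_n) :
    flag_type R n :=
  [ffun i : 'I_n.+1 => <<[seq col j U | j : 'I_n <- enum 'I_n & (j < i)%N]>>%VS].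

(* The value on a class is computed from an arbitrary representative; it does
   not depend on that representative by left_identE. *)
Definition left_ident (R : realType) (n : nat) (lam : 'I_n -> R)
    (c : set 'M[R[i]]_n) : 'M[R[i]]_n :=
  xget 0 [set invmx U *m Lambda_mx lam *m U | U in c].

(* As above, with right_identE. *)
Definition right_ident (R : realType) (n : nat) (c : set 'M[R[i]]_n) :
    flag_type R n :=
  xget (column_flag 0) [set column_flag U | U in c].

Lemma diag_torus1 (R : realType) (n : nat) : @diag_torus R n 1%:M.
Proof.
split; first exact: scalar_mx_is_diag.
by apply/unitarymxP; rewrite trmx1 map_mx1 mulmx1.
Qed.

Lemma left_identE (R : realType) (n : nat) (lam : 'I_n -> R)
    (U : 'M[R[i]]_n) :
  @unitary_group R n U ->
  left_ident lam (left_class U) = invmx U *m Lambda_mx lam *m U.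
Proof.
move=> Uu; rewrite /left_ident.
have Uunit : U \in unitmx by exact: unitarymx_unit.
case: xgetP => [_ _ [_ [t [td tu] <-] <-]|]; last first.
  move=> /(_ (invmx U *m Lambda_mx lam *m U)) /=; case; exists U => //.
  by exists 1%:M; rewrite ?mul1mx//; exact: diag_torus1.
have tunit : t \in unitmx by exact: unitarymx_unit.
have invM : invmx (t *m U) = invmx U *m invmx t.
  have tUunit : t *m U \in unitmx by rewrite unitmx_mul tunit.
  apply: (can_inj (mulKmx tUunit)); rewrite mulmxV//.
  by rewrite -mulmxA (mulmxA U) mulmxV// mul1mx mulmxV.
have tL : t *m Lambda_mx lam = Lambda_mx lam *m t.
  by have /diag_mxP [v ->] := td; rewrite /Lambda_mx diag_mxC.
by rewrite invM !mulmxA -(mulmxA _ _ t) -tL !mulmxA mulmxKV.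
Qed.

Lemma right_identE (R : realType) (n : nat) (U : 'M[R[i]]_n) :
  right_ident (right_class U) = column_flag U.
Proof.
rewrite /right_ident.
case: xgetP => [_ _ [_ [t [td tu] <-] <-]|]; last first.
  move=> /(_ (column_flag U)) /=; case; exists U => //.
  by exists 1%:M; rewrite ?mulmx1//; exact: diag_torus1.
have tunit : t \in unitmx by exact: unitarymx_unit.
have /diag_mxP [v tE] := td.
have colE j : col j (U *m t) = v 0 j *: col j U.
  apply/matrixP => a b; rewrite tE mul_mx_diag !mxE mulrC; congr (_ * _).
have v0 j : v 0 j != 0.
  apply: contraL tunit => /eqP vj0; rewrite tE unitmxE unitfE det_diag.
  by rewrite negbK prodf_seq_eq0; apply/hasP; exists j; rewrite ?mem_index_enum ?vj0/=.
apply/ffunP => i; rewrite !ffunE; apply/eqP; rewrite eqEsubv.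
apply/andP; split; apply/span_subvP => _ /mapP [j jP ->].
  by rewrite colE memvZ// memv_span//; apply: map_f.
rewrite -(scale1r (col j U)) -(mulVf (v0 j)) -scalerA -colE memvZ//.
by rewrite memv_span//; apply: map_f.
Qed.

(* Main.v *)
Require Import Defs.
From HB Require Import structures.
From mathcomp Require Import all_boot all_order all_algebra.
From mathcomp Require Import fingroup perm.
From mathcomp Require Import all_classical all_reals.
From mathcomp Require Import topology normedtype landau derive realfun.
From mathcomp Require Import complex.
From mathcomp Require Import ring.

Set Implicit Arguments.
Unset Strict Implicit.
Unset Printing Implicit Defensive.

Import Order.TTheory GRing.Theory Num.Theory.
Import numFieldNormedType.Exports.
Local Open Scope classical_set_scope.
Local Open Scope ring_scope.
Local Open Scope sesquilinear_scope.

(* Z is the set of unitary U such that U^-1 Lambda U vanishes below the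
   staircase; being Hermitian, it then vanishes above the staircase as well.
   Multiplying U on the right by an upper triangular matrix preserves the
   condition, as h is nondecreasing.

   Charts come from the big cells of the flag variety, which makes the implicit
   function theorem unnecessary.  Near a given point there is a permutation
   matrix W such that W U = L S^-1 with L lower unitriangular and S upper
   triangular.  With D = W Lambda W^-1, diagonal with distinct entries, U lies
   in Z if and only if L^-1 D L vanishes below the staircase.  The map from L to
   L^-1 D L - D is a bijection from the lower unitriangular matrices to the
   strictly lower triangular ones: its inverse diagonalises a triangular matrix
   with distinct diagonal entries.  So the entries of L^-1 D L - D, together
   with the arguments of the diagonal of S, are coordinates on U(n) in which Z is a
   coordinate subspace.  Conversely U is recovered from L by Gram-Schmidt. *)

(** * Calculus of maps of class C^k *)

(** The difference [g - f] vanishes near [x], so it has the zero map as differential there, and [g]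
    is [f] plus this difference. *)
Lemma near_eq_differentiable (R : realType) (V W : normedModType R)
    (f g : V -> W) (x : V) :
  (\near x, f x = g x) -> differentiable f x -> differentiable g x.
Proof.
move=> fg df.
pose z : {linear V -> W} := \0%R.
have r0 : (g - f) \o shift x = cst ((g - f) x) + (z : V -> W) +o_ 0 id.
  have rx : (g - f) x = 0 by rewrite -[LHS]/(g x - f x) (nbhs_singleton fg) subrr.
  apply/eqaddoP => e e0; near=> y.
  rewrite -[X in `|X|]/(g (y + x) - f (y + x) - ((g - f) x + 0)) rx addr0 subr0.
  suff -> : f (y + x) = g (y + x) by rewrite subrr normr0 mulr_ge0// ltW.
  near: y; move: fg; rewrite (near_shift 0 x)/= => fg.
  by apply: filterS fg => y /=; rewrite subr0.
have c0 : continuous z by move=> y; exact: cvg_cst.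
have d0 : 'd (g - f) x = z :> (V -> W) by exact: diff_unique.
have dr : differentiable (g - f) x.
  by apply/diff_locallyP; rewrite d0; split => //; exact: c0.
by rewrite -(subrK f g); exact: differentiableD.
Unshelve. all: by end_near. Qed.

Section SmoothFunctions.
Variables (R : realType) (V : normedModType R) (O : set V).
Hypothesis openO : open O.

(** As [O] is open, agreement on [O] is agreement near each of its points, so directional
    derivatives agree on [O] as well and the induction on [k] goes through. *)
Lemma Ck_ext (W : normedModType R) k (f g : V -> W) :
  {in O, f =1 g} -> Ck k O f -> Ck k O g.
Proof.
have nearO (f' g' : V -> W) x : O x -> {in O, f' =1 g'} -> \near x, f' x = g' x.
  move=> Ox fg; have : nbhs x O by exact: open_nbhs_nbhs.
  by apply: filterS => y Oy; apply: fg; rewrite inE.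
elim: k f g => [|k IH] f g fg /=.
  move=> cf x Ox; have := cf x Ox; rewrite /prop_for/continuous_at.
  rewrite -(fg x) ?inE// => cfx; apply: cvg_trans cfx.
  apply/near_eq_cvg; apply: nearO => //; exact: fg.
move=> [df Df]; split => [x Ox|v].
  by apply: near_eq_differentiable (df x Ox); exact: nearO.
apply: (IH ('D_v f)) => [x|]; last exact: Df.
by rewrite inE => Ox; apply: near_eq_derive; apply: nearO.
Qed.

Lemma CkW (W : normedModType R) k (f : V -> W) : Ck k.+1 O f -> Ck k O f.
Proof.
elim: k f => [|k IH] f [df Df].
  by move=> x Ox; apply: differentiable_continuous; exact: df.
by split => // v; exact/IH/Df.
Qed.

Lemma Ck_cst (W : normedModType R) k (c : W) : Ck k O (cst c).
Proof.
elim: k c => [|k IH] c /=; first by move=> x _; exact: cvg_cst.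
split=> [x _|v]; first exact: differentiable_cst.
by apply: Ck_ext (IH 0) => x _; rewrite derive_cst.
Qed.

Lemma Ck_linear (W : normedModType R) k (f : {linear V -> W}) :
  continuous f -> Ck k O f.
Proof.
move=> cf; case: k => [x _|k]; first exact: cf.
split => [x _|v]; first exact: linear_differentiable.
apply: Ck_ext (@Ck_cst _ k (f v)) => x _.
by rewrite deriveE ?diff_lin//; exact: linear_differentiable.
Qed.

Lemma CkD (W : normedModType R) k (f g : V -> W) :
  Ck k O f -> Ck k O g -> Ck k O (f + g).
Proof.
elim: k f g => [|k IH] f g.
  by move=> cf cg x Ox; apply: cvgD; [exact: cf|exact: cg].
move=> [df Df] [dg Dg]; split=> [x Ox|v].
  by apply: differentiableD; [exact: df|exact: dg].
apply: Ck_ext (IH _ _ (Df v) (Dg v)) => x; rewrite inE => Ox.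
by rewrite deriveD//; apply: diff_derivable; [exact: df|exact: dg].
Qed.

Lemma CkM k (f g : V -> R) : Ck k O f -> Ck k O g -> Ck k O (f * g).
Proof.
elim: k f g => [|k IH] f g.
  by move=> cf cg x Ox; apply: cvgM; [exact: cf|exact: cg].
move=> Cf Cg; have [df Df] := Cf; have [dg Dg] := Cg; split=> [x Ox|v].
  by apply: differentiableM; [exact: df|exact: dg].
apply: Ck_ext (CkD (IH _ _ (CkW Cf) (Dg v)) (IH _ _ (CkW Cg) (Df v))) => x.
rewrite inE => Ox.
by rewrite deriveM//; apply: diff_derivable; [exact: df|exact: dg].
Qed.

(** The derivative [- f^-2 * 'D_v f] involves [f^-1] itself only to order [k], which the induction
    hypothesis supplies. *)
Lemma CkV k (f : V -> R) : (forall x, O x -> f x != 0) ->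
  Ck k O f -> Ck k O (fun x => (f x)^-1).
Proof.
move=> f0; elim: k => [|k IH].
  by move=> cf x Ox; apply: cvgV; [exact: f0|exact: cf].
move=> Cf; have [df Df] := Cf; have Ci := IH (CkW Cf); split=> [x Ox|v].
  by apply: differentiableV; [exact: df|exact: f0].
apply: Ck_ext (CkM (CkM (@Ck_cst R k (-1)) (CkM Ci Ci)) (Df v)) => x.
rewrite inE => Ox; rewrite deriveV//; last 2 first.
- exact: f0.
- by apply: diff_derivable; exact: df.
by rewrite !fctE/= expr2 invfM mulN1r.
Qed.

(** Same induction as for the inverse: the derivative is one half of ['D_v f] divided by the square
    root itself. *)
Lemma Ck_sqrt k (f : V -> R) : (forall x, O x -> 0 < f x) ->
  Ck k O f -> @Ck R V R k O (fun x => Num.sqrt (f x)).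
Proof.
move=> f0; elim: k => [|k IH].
  move=> cf x Ox; apply: (@continuous_comp _ _ _ f Num.sqrt); first exact: cf.
  exact: sqrt_continuous.
move=> Cf; have [df Df] := Cf; have Cs := IH (CkW Cf).
have ds x : O x -> differentiable (Num.sqrt : R -> R) (f x).
  move=> Ox; apply/derivable1_diffP; apply: ex_derive.
  by apply: is_derive1_sqrt; exact: f0.
split=> [x Ox|v].
  by apply: (@differentiable_comp _ _ _ _ f Num.sqrt); [exact: df|exact: ds].
have s0 x : O x -> Num.sqrt (f x) != 0.
  by move=> Ox; rewrite gt_eqF// sqrtr_gt0 f0.
apply: Ck_ext (CkM (CkM (@Ck_cst R k (2^-1)) (CkV s0 Cs)) (Df v)) => x.
rewrite inE => Ox.
have dc : differentiable ((Num.sqrt : R -> R) \o f) x.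
  by apply: differentiable_comp; [exact: df|exact: ds].
apply: (@eq_trans _ _ _ _ _ (esym (deriveE v dc))).
rewrite diff_comp; [|exact: df|exact: ds].
rewrite /= diff1E; last exact: ds.
rewrite derive1E derive_sqrt ?f0// -(deriveE v (df x Ox)) invfM.
by rewrite -[RHS]/('D_v f x * _) mulrC.
Qed.

Lemma Ck_scaler (W : normedModType R) k (f : V -> R) (w : W) :
  Ck k O f -> Ck k O (fun x => f x *: w).
Proof.
elim: k f => [|k IH] f.
  by move=> cf x Ox; apply: cvgZl; exact: cf.
move=> [df Df]; split=> [x Ox|v].
  by apply: differentiableZl; exact: df.
apply: Ck_ext (IH _ (Df v)) => x; rewrite inE => Ox.
rewrite !deriveE ?diffZl//=; first exact: df.
- by apply: differentiableZl; exact: df.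
- exact: df.
Qed.

Lemma Ck_sum (W : normedModType R) k (I : Type) (r : seq I) (P : pred I)
    (f : I -> V -> W) :
  (forall i, Ck k O (f i)) -> Ck k O (fun x => \sum_(i <- r | P i) f i x).
Proof.
move=> Cf; elim: r => [|i r IH].
  by apply: Ck_ext (@Ck_cst _ k 0) => x _; rewrite big_nil.
have [Pi|/negbTE Pi] := boolP (P i).
  by apply: Ck_ext (CkD (Cf i) IH) => x _; rewrite big_cons Pi.
by apply: Ck_ext IH => x _; rewrite big_cons Pi.
Qed.

Definition smooth_fun (W : normedModType R) (f : V -> W) := forall k, Ck k O f.

(** Expansion in elementary matrices reduces the claim to scalar functions times constant
    vectors. *)
Lemma smooth_fun_mx m n (f : V -> 'M[R]_(m, n)) :
  (forall i j, smooth_fun (fun x => f x i j)) -> smooth_fun f.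
Proof.
move=> Cf k; have := @Ck_sum 'M[R]_(m, n) k _ (index_enum _) predT
  (fun p x => f x p.1 p.2 *: delta_mx p.1 p.2).
move=> /(_ (fun p => Ck_scaler _ (Cf p.1 p.2 k))); apply: Ck_ext => x _.
by rewrite [RHS]matrix_sum_delta pair_big.
Qed.

Lemma smooth_fun_pair (W1 W2 : normedModType R) (f : V -> W1) (g : V -> W2) :
  smooth_fun f -> smooth_fun g -> smooth_fun (fun x => (f x, g x)).
Proof.
move=> sf sg k; elim: k f g sf sg => [|k IH] f g sf sg.
  by move=> x Ox; apply: cvg_pair; [exact: (sf 0%N)|exact: (sg 0%N)].
split=> [x Ox|v].
  by apply: differentiable_pair; [exact: (sf 1%N).1|exact: (sg 1%N).1].
have := IH ('D_v f) ('D_v g) (fun k => (sf k.+1).2 v) (fun k => (sg k.+1).2 v).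
apply: Ck_ext => x; rewrite inE => Ox.
have df : differentiable f x by exact: (sf 1%N).1.
have dg : differentiable g x by exact: (sg 1%N).1.
rewrite [RHS]deriveE; last exact: differentiable_pair.
by rewrite diff_pair//= !deriveE.
Qed.

End SmoothFunctions.

(** * Real smoothness of complex-valued and complex-matrix-valued maps *)

Section ComplexParts.
Variable R : realType.
Implicit Types z w : R[i].

Lemma Re_mulc z w :
  complex.Re (z * w) = complex.Re z * complex.Re w - complex.Im z * complex.Im w.
Proof. by case: z => a b; case: w. Qed.

Lemma Im_mulc z w :
  complex.Im (z * w) = complex.Re z * complex.Im w + complex.Im z * complex.Re w.
Proof. by case: z => a b; case: w. Qed.

Lemma Re_invc z :
  complex.Re z^-1 = complex.Re z / (complex.Re z ^+ 2 + complex.Im z ^+ 2).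
Proof. by case: z. Qed.

Lemma Im_invc z :
  complex.Im z^-1 = - (complex.Im z / (complex.Re z ^+ 2 + complex.Im z ^+ 2)).
Proof. by case: z. Qed.

Lemma Re_conjC z : complex.Re z^* = complex.Re z.
Proof. by case: z. Qed.

Lemma Im_conjC z : complex.Im z^* = - complex.Im z.
Proof. by case: z. Qed.

Lemma sqr_Re_Im_gt0 z :
  (0 < complex.Re z ^+ 2 + complex.Im z ^+ 2) = (z != 0).
Proof.
rewrite lt0r addr_ge0 ?sqr_ge0// andbT paddr_eq0 ?sqr_ge0//.
by rewrite !sqrf_eq0 eq_complex.
Qed.

End ComplexParts.

Section ComplexSmooth.
Variables (R : realType) (V : normedModType R) (O : set V).
Hypothesis openO : open O.

(** Smoothness over the reals rather than holomorphy, since conjugates and squared moduli enter the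
    charts. *)
Definition csmooth (f : V -> R[i]) :=
  smooth_fun O (fun x => complex.Re (f x)) /\
  smooth_fun O (fun x => complex.Im (f x)).

Lemma smooth_ext (W : normedModType R) (f g : V -> W) :
  {in O, f =1 g} -> smooth_fun O f -> smooth_fun O g.
Proof. by move=> fg sf k; apply: Ck_ext (sf k). Qed.

Lemma smoothN (f : V -> R) : smooth_fun O f -> smooth_fun O (fun x => - f x).
Proof.
move=> sf k; apply: (Ck_ext openO) (CkM openO (@Ck_cst R V O openO R k (-1)) (sf k)).
by move=> x _; rewrite -[LHS]/(-1 * f x) mulN1r.
Qed.

Lemma csmooth_ext f g : {in O, f =1 g} -> csmooth f -> csmooth g.
Proof.
by move=> fg [rf mf]; split; [apply: smooth_ext rf|apply: smooth_ext mf];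
  move=> x xO; rewrite fg.
Qed.

Lemma csmooth_cst c : csmooth (cst c).
Proof. by split=> k; exact: Ck_cst. Qed.

Lemma csmoothD f g : csmooth f -> csmooth g -> csmooth (fun x => f x + g x).
Proof.
move=> [rf mf] [rg mg]; split=> k.
  by apply: Ck_ext (CkD openO (rf k) (rg k)) => // x _; rewrite /= raddfD.
by apply: Ck_ext (CkD openO (mf k) (mg k)) => // x _; rewrite /= raddfD.
Qed.

Lemma csmoothM f g : csmooth f -> csmooth g -> csmooth (fun x => f x * g x).
Proof.
move=> [rf mf] [rg mg]; split=> k.
  have sN := smoothN (fun k => CkM openO (mf k) (mg k)).
  have := CkD openO (CkM openO (rf k) (rg k)) (sN k).
  by apply: Ck_ext => // x _; rewrite Re_mulc.
have := CkD openO (CkM openO (rf k) (mg k)) (CkM openO (mf k) (rg k)).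
by apply: Ck_ext => // x _; rewrite Im_mulc.
Qed.

Lemma smooth_sqnorm f : csmooth f ->
  smooth_fun O (fun x => complex.Re (f x) ^+ 2 + complex.Im (f x) ^+ 2).
Proof.
move=> [rf mf] k.
exact: (CkD openO (CkM openO (rf k) (rf k)) (CkM openO (mf k) (mf k))).
Qed.

Lemma csmoothV f : (forall x, O x -> f x != 0) -> csmooth f ->
  csmooth (fun x => (f x)^-1).
Proof.
move=> f0 sf; have sn := smooth_sqnorm sf; have [rf mf] := sf.
have n0 x : O x -> complex.Re (f x) ^+ 2 + complex.Im (f x) ^+ 2 != 0.
  by move=> Ox; rewrite gt_eqF// sqr_Re_Im_gt0 f0.
have iP k := CkV openO n0 (sn k).
split=> k.
  by apply: Ck_ext (CkM openO (rf k) (iP k)) => // x _; rewrite Re_invc.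
apply: Ck_ext (smoothN (fun k => CkM openO (mf k) (iP k)) k) => // x _.
by rewrite Im_invc.
Qed.

Lemma csmooth_conj f : csmooth f -> csmooth (fun x => (f x)^*).
Proof.
move=> [rf mf]; split.
  by apply: smooth_ext rf => x _; rewrite Re_conjC.
by apply: smooth_ext (smoothN mf) => x _; rewrite Im_conjC.
Qed.

Lemma csmooth_sum (I : Type) (r : seq I) (P : pred I) (f : I -> V -> R[i]) :
  (forall i, csmooth (f i)) -> csmooth (fun x => \sum_(i <- r | P i) f i x).
Proof.
move=> Cf; elim: r => [|i r IH].
  by apply: csmooth_ext (csmooth_cst 0) => x _; rewrite big_nil.
have [Pi|/negbTE Pi] := boolP (P i).
  by apply: csmooth_ext (csmoothD (Cf i) IH) => x _; rewrite big_cons Pi.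
by apply: csmooth_ext IH => x _; rewrite big_cons Pi.
Qed.

Lemma csmooth_prod (I : Type) (r : seq I) (P : pred I) (f : I -> V -> R[i]) :
  (forall i, csmooth (f i)) -> csmooth (fun x => \prod_(i <- r | P i) f i x).
Proof.
move=> Cf; elim: r => [|i r IH].
  by apply: csmooth_ext (csmooth_cst 1) => x _; rewrite big_nil.
have [Pi|/negbTE Pi] := boolP (P i).
  by apply: csmooth_ext (csmoothM (Cf i) IH) => x _; rewrite big_cons Pi.
by apply: csmooth_ext IH => x _; rewrite big_cons Pi.
Qed.

Lemma csmooth_real (f : V -> R) : smooth_fun O f -> csmooth (fun x => (f x)%:C%C).
Proof. by move=> sf; split => // k; exact: (@Ck_cst R V O openO R k 0). Qed.

Definition mxsmooth m n (F : V -> 'M[R[i]]_(m, n)) :=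
  forall i j, csmooth (fun x => F x i j).

Lemma mxsmooth_cst m n (A : 'M_(m, n)) : mxsmooth (cst A).
Proof. by move=> i j; exact: csmooth_cst. Qed.

Lemma mxsmoothD m n (F G : V -> 'M_(m, n)) :
  mxsmooth F -> mxsmooth G -> mxsmooth (fun x => F x + G x).
Proof.
move=> sF sG i j; apply: csmooth_ext (csmoothD (sF i j) (sG i j)) => x _.
by rewrite mxE.
Qed.

Lemma mxsmoothM m n p (F : V -> 'M_(m, n)) (G : V -> 'M_(n, p)) :
  mxsmooth F -> mxsmooth G -> mxsmooth (fun x => F x *m G x).
Proof.
move=> sF sG i j.
have := csmooth_sum (index_enum _) predT
  (fun k => csmoothM (sF i k) (sG k j)).
by apply: csmooth_ext => x _; rewrite mxE.
Qed.

Lemma mxsmooth_trmxC m n (F : V -> 'M_(m, n)) :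
  mxsmooth F -> mxsmooth (fun x => (F x) ^t*).
Proof.
by move=> sF i j; apply: csmooth_ext (csmooth_conj (sF j i)) => x _; rewrite !mxE.
Qed.

Lemma csmooth_det n (F : V -> 'M_n) : mxsmooth F -> csmooth (fun x => \det (F x)).
Proof.
move=> sF; rewrite /determinant.
apply: csmooth_sum => s; apply: csmoothM; first exact: csmooth_cst.
by apply: csmooth_prod => i; exact: sF.
Qed.

(** Cramer's rule: the inverse is the adjugate over the determinant, both polynomial in the
    entries. *)
Lemma mxsmoothV n (F : V -> 'M_n) : (forall x, O x -> F x \in unitmx) ->
  mxsmooth F -> mxsmooth (fun x => invmx (F x)).
Proof.
move=> uF sF i j.
have d0 x : O x -> \det (F x) != 0 by move=> /uF; rewrite unitmxE unitfE.
have s_adj : csmooth (fun x => (\adj (F x)) i j).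
  have : csmooth (fun x => (-1) ^+ (j + i) * \det (row' j (col' i (F x)))).
    apply: csmoothM; first exact: csmooth_cst.
    apply: csmooth_det => a b.
    by apply: csmooth_ext (sF (lift j a) (lift i b)) => x _; rewrite !mxE.
  by apply: csmooth_ext => x _; rewrite mxE.
apply: csmooth_ext (csmoothM (csmoothV d0 (csmooth_det sF)) s_adj) => x.
by rewrite inE => Ox; rewrite /invmx uF// [RHS]mxE.
Qed.

Lemma open_posI (I : finType) (f : I -> V -> R) :
  (forall i, smooth_fun O (f i)) -> open (O `&` [set x | forall i, 0 < f i x]).
Proof.
move=> sf; rewrite openE => x [Ox fx]; apply: filterI.
  exact: open_nbhs_nbhs.
apply: filter_forall => i.
have /= cf := sf i 0%N x Ox.
by apply: (@cvgr_gt R V (nbhs x) _ (f i) (f i x) cf 0); exact: fx.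
Qed.

End ComplexSmooth.

(** * Triangular factorizations *)

Section Triangular.
Variables (F : fieldType) (n : nat).
Implicit Types A B L S T : 'M[F]_n.

Definition unitrig_mx A := is_trig_mx A /\ forall i, A i i = 1.

Lemma mulmx_trig A B : is_trig_mx A -> is_trig_mx B -> is_trig_mx (A *m B).
Proof.
move=> /is_trig_mxP tA /is_trig_mxP tB; apply/is_trig_mxP => i j ij.
rewrite mxE big1// => k _; have [ik|ki] := ltnP i k; first by rewrite tA ?mul0r.
by rewrite tB ?mulr0// (leq_ltn_trans ki).
Qed.

Lemma mulmx_trig_diag A B i : is_trig_mx A -> is_trig_mx B ->
  (A *m B) i i = A i i * B i i.
Proof.
move=> /is_trig_mxP tA /is_trig_mxP tB.
rewrite mxE (bigD1 i)//= big1 ?addr0// => k; rewrite neq_ltn => /orP[ki|ik].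
  by rewrite tB ?mulr0.
by rewrite tA ?mul0r.
Qed.

Lemma trig_unitmx A : is_trig_mx A -> (A \in unitmx) = [forall i, A i i != 0].
Proof.
move=> tA; rewrite unitmxE det_trig// unitfE prodf_seq_neq0/=.
by apply/allP/forallP => [h i|h i _]; [rewrite h ?mem_index_enum|].
Qed.

Lemma invmx_trig A : A \in unitmx -> is_trig_mx A -> is_trig_mx (invmx A).
Proof.
move=> uA tA; have := uA; rewrite trig_unitmx// => /forallP dA.
(* Strong induction on the row. In the entry [(i, j)] of [A *m invmx A], the terms [k < i] vanish by
   induction and the terms [k > i] by triangularity of [A]. *)
apply/is_trig_mxP => i j; have [m] := ubnP i; elim: m i => // m IH i im ij.
have := congr1 (fun M : 'M_n => M i j) (mulmxV uA).
rewrite !mxE (bigD1 i)//= big1 => [|k]; last first.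
  rewrite neq_ltn => /orP[ki|ik].
    by rewrite (IH k (leq_trans ki im) (ltn_trans ki ij)) mulr0.
  by move/is_trig_mxP: tA => ->//; rewrite mul0r.
rewrite addr0 -val_eqE/= (ltn_eqF ij) => /eqP; rewrite mulf_eq0.
by rewrite (negbTE (dA i)) => /eqP.
Qed.

Lemma unitrig_unitmx A : unitrig_mx A -> A \in unitmx.
Proof.
by move=> [tA dA]; rewrite trig_unitmx//; apply/forallP => i; rewrite dA oner_eq0.
Qed.

Lemma unitrig_inv A : unitrig_mx A -> unitrig_mx (invmx A).
Proof.
move=> uA; have [tA dA] := uA; have uA' := unitrig_unitmx uA.
split=> [|i]; first exact: invmx_trig.
have := congr1 (fun M : 'M_n => M i i) (mulmxV uA').
by rewrite mulmx_trig_diag ?invmx_trig// dA mul1r !mxE eqxx.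
Qed.

Lemma unitrig_trig_diag A (i j : 'I_n) : unitrig_mx A -> (i <= j)%N ->
  A i j = (i == j)%:R.
Proof.
move=> [/is_trig_mxP tA dA]; rewrite leq_eqVlt => /orP[/eqP/val_inj ->|ij].
  by rewrite eqxx dA.
by rewrite tA// -val_eqE/= ltn_eqF.
Qed.

Definition upper_mx A := is_trig_mx A^T.

Lemma upper_mxP A :
  reflect (forall i j : 'I_n, (j < i)%N -> A i j = 0) (upper_mx A).
Proof.
apply: (iffP is_trig_mxP) => h i j ij; have := h j i ij; by rewrite mxE.
Qed.

Lemma mulmx_upper A B : upper_mx A -> upper_mx B -> upper_mx (A *m B).
Proof. by rewrite /upper_mx trmx_mul => uA uB; exact: mulmx_trig. Qed.

Lemma mulmx_upper_diag A B i : upper_mx A -> upper_mx B ->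
  (A *m B) i i = A i i * B i i.
Proof.
rewrite /upper_mx => uA uB; have := mulmx_trig_diag i uB uA.
by rewrite -trmx_mul !mxE mulrC.
Qed.

Lemma upper_unitmx A : upper_mx A -> (A \in unitmx) = [forall i, A i i != 0].
Proof.
move=> uA; rewrite -unitmx_tr trig_unitmx//; apply: eq_forallb => i.
by rewrite mxE.
Qed.

Lemma invmx_upper A : A \in unitmx -> upper_mx A -> upper_mx (invmx A).
Proof.
by rewrite /upper_mx trmx_inv => uA; apply: invmx_trig; rewrite unitmx_tr.
Qed.

Lemma invmx_upper_diag A i : A \in unitmx -> upper_mx A ->
  invmx A i i = (A i i)^-1.
Proof.
move=> uA tA; have := congr1 (fun M : 'M_n => M i i) (mulVmx uA).
rewrite mulmx_upper_diag ?invmx_upper// mxE eqxx => /esym e1.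
have := uA; rewrite upper_unitmx// => /forallP/(_ i) d0.
by apply: (mulIf d0); rewrite -e1 mulVf.
Qed.

Lemma diag_mx_upper (v : 'rV[F]_n) : upper_mx (diag_mx v).
Proof. by rewrite /upper_mx tr_diag_mx diag_mx_is_trig. Qed.

(* The columns of B of index at most j, completed by those of the identity:
   its determinant is the leading principal minor of B of order j.+1. *)
Definition lead_mx (j : 'I_n) B : 'M[F]_n :=
  \matrix_(a, b) if (b <= j)%N then B a b else (a == b)%:R.

(** As [T] is upper triangular, the columns of [B *m T] of index at most [j] involve only the
    columns of [B] of index at most [j]. *)
Lemma lead_mxM j B T : upper_mx T ->
  lead_mx j B *m lead_mx j T = lead_mx j (B *m T).
Proof.
move=> /upper_mxP uT; apply/matrixP => a b; rewrite !mxE.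
case: ifP => bj.
  apply: eq_bigr => c _; rewrite !mxE bj; case: ifP => // cj.
  by rewrite uT ?mulr0// (leq_ltn_trans bj)// ltnNge cj.
rewrite (bigD1 b)//= big1 ?addr0 => [|c cb]; rewrite !mxE bj ?eqxx ?mulr1//.
by rewrite (negbTE cb) mulr0.
Qed.

Lemma lead_mx_unitrig j L : unitrig_mx L -> unitrig_mx (lead_mx j L).
Proof.
move=> [/is_trig_mxP tL dL]; split=> [|i]; last first.
  by rewrite mxE dL eqxx if_same.
apply/is_trig_mxP => a b ab; rewrite mxE tL//.
by rewrite -val_eqE/= ltn_eqF// if_same.
Qed.

Lemma lead_mx_upper j T : upper_mx T -> upper_mx (lead_mx j T).
Proof.
move=> /upper_mxP uT; apply/upper_mxP => a b ab; rewrite mxE uT//.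
by rewrite -val_eqE/= gtn_eqF// if_same.
Qed.

Lemma lead_mx_upper_unit j T :
  T \in unitmx -> upper_mx T -> lead_mx j T \in unitmx.
Proof.
move=> uT tT; move: uT; rewrite !upper_unitmx ?lead_mx_upper//.
move=> /forallP dT; apply/forallP => i.
by rewrite mxE; case: ifP => // _; rewrite eqxx oner_eq0.
Qed.

(* When all leading principal minors of B are invertible this is the upper
   triangular S for which B *m S is lower unitriangular: the inverse of the
   factor U of the decomposition B = L U. *)
Definition lu_inv B : 'M[F]_n :=
  \matrix_(b, j) if (b <= j)%N then invmx (lead_mx j B) b j else 0.

Lemma lu_inv_upper B : upper_mx (lu_inv B).
Proof. by apply/upper_mxP => i j ij; rewrite mxE leqNgt ij. Qed.

(** Column [j] of the inverse of [lead_mx j B] is sent by [lead_mx j B] to the [j]-th basis vector.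
    In a row [i <= j] the completing identity columns contribute nothing, so its entries past [j]
    may be cut off. *)
Lemma lu_inv_unitrig B : (forall j, lead_mx j B \in unitmx) ->
  unitrig_mx (B *m lu_inv B).
Proof.
move=> uB; suff e (i j : 'I_n) : (i <= j)%N -> (B *m lu_inv B) i j = (i == j)%:R.
  split=> [|i]; last by rewrite e// eqxx.
  by apply/is_trig_mxP => i j ij; rewrite e 1?ltnW// -val_eqE/= ltn_eqF.
move=> ij; have := congr1 (fun M : 'M_n => M i j) (mulmxV (uB j)).
rewrite !mxE => <-; apply: eq_bigr => b _; rewrite !mxE; case: ifP => // bj.
by rewrite mulr0 -val_eqE/= ltn_eqF ?mul0r// (leq_ltn_trans ij)// ltnNge bj.
Qed.

(** By [lead_mxM], [lead_mx j B] is a left factor of the unitriangular [lead_mx j (B *m T)]. *)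
Lemma lead_mx_unit B T : upper_mx T -> unitrig_mx (B *m T) ->
  forall j, lead_mx j B \in unitmx.
Proof.
move=> uT uBT j; have := unitrig_unitmx (lead_mx_unitrig j uBT).
by rewrite -lead_mxM// unitmx_mul => /andP[].
Qed.

Lemma lu_inv_unique B T : upper_mx T -> unitrig_mx (B *m T) -> lu_inv B = T.
Proof.
move=> uT uBT; apply/matrixP => b j; rewrite mxE.
case: ifP => bj; last by move/upper_mxP: uT => -> //; rewrite ltnNge bj.
have uC := lead_mx_unit uT uBT j.
(* Column [c] of [lead_mx j B] is a basis vector. Hence, in the sum expressing [T b j] through the
   inverse, the terms [c > j] vanish; those with [c < j] vanish by unitriangularity of [B *m T]. *)
have CE (c : 'I_n) : (j < c)%N -> invmx (lead_mx j B) b c = 0.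
  move=> jc; have := congr1 (fun M : 'M_n => M b c) (mulVmx uC).
  rewrite !mxE (bigD1 c)//= big1 => [|d dc].
    rewrite mxE leqNgt jc/= eqxx mulr1 addr0 => ->.
    by rewrite -val_eqE/= ltn_eqF// (leq_ltn_trans bj).
  by rewrite !mxE leqNgt jc/= (negbTE dc) mulr0.
have := congr1 (fun M => (invmx (lead_mx j B) *m M) b j) (lead_mxM j B uT).
rewrite mulKmx// mxE leqnn => ->; rewrite mxE (bigD1 j)//= big1 => [|c cj].
  by rewrite mxE leqnn (unitrig_trig_diag uBT)// eqxx mulr1 addr0.
have [jc|cj'] := ltnP j c; first by rewrite CE ?mul0r.
by rewrite mxE leqnn (unitrig_trig_diag uBT)// (negbTE cj) mulr0.
Qed.

Lemma lu_inv_unit B : (forall j, lead_mx j B \in unitmx) -> lu_inv B \in unitmx.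
Proof.
by move=> /lu_inv_unitrig/unitrig_unitmx; rewrite unitmx_mul => /andP[].
Qed.

End Triangular.

(** The LUP decomposition provides [s]: both factors of [perm_mx s *m A = L *m U] have invertible
    leading parts, and [lead_mxM] multiplies them. *)
Lemma lead_mx_exists (F : fieldType) (n : nat) (A : 'M[F]_n) : A \in unitmx ->
  exists s : 'S_n, forall j, lead_mx j (perm_mx s *m A) \in unitmx.
Proof.
case: n A => [|m] A uA; first by exists 1%g => - [].
have := cormen_lup_correct A; have := cormen_lup_perm A.
have := @cormen_lup_lower _ _ A; have := @cormen_lup_upper _ _ A.
case: (cormen_lup A) => -[P L U]/= Uu Ll /is_perm_mxP[s ->] e.
have uL : unitrig_mx L.
  split=> [|i]; last by rewrite Ll ?eqxx.
  by apply/is_trig_mxP => i j ij; rewrite Ll 1?ltnW// -val_eqE/= ltn_eqF.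
have tU : upper_mx U by apply/upper_mxP.
have uU : U \in unitmx.
  have : perm_mx s *m A \in unitmx by rewrite unitmx_mul unitmx_perm.
  by rewrite -[_ *m _]/(perm_mx s * A) e unitmx_mul => /andP[].
exists s => j; rewrite -[_ *m _]/(perm_mx s * A) e -[L * U]/(L *m U).
by rewrite -lead_mxM// unitmx_mul (lead_mx_upper_unit _ uU tU) andbT;
  exact/unitrig_unitmx/lead_mx_unitrig.
Qed.

(** * Diagonalization of triangular matrices with distinct diagonal entries *)

Lemma row_mul_diag_mx (R : pzRingType) m n (d : 'rV[R]_m) (A : 'M[R]_(m, n)) i :
  row i (diag_mx d *m A) = d 0 i *: row i A.
Proof. by apply/rowP => j; rewrite mul_diag_mx !mxE. Qed.

Section Diagonalizer.
Variables (F : fieldType) (n : nat) (d : 'rV[F]_n).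
Hypothesis d_inj : forall i j, d 0 i = d 0 j -> i = j.
Implicit Types L N : 'M[F]_n.

(* For N lower triangular with distinct diagonal entries, the matrix N minus
   its i-th diagonal entry, modified to be invertible without changing its left
   kernel vector: the i-th row of the inverse is the left eigenvector of N for
   N i i, normalised to have i-th coordinate 1. *)
Definition eig_mx (i : 'I_n) N := N - (N i i)%:M + delta_mx i i.

Definition eigrows N : 'M[F]_n := \matrix_(i, j) invmx (eig_mx i N) i j.

Lemma eig_mx_trig i N : is_trig_mx N -> is_trig_mx (eig_mx i N).
Proof.
move=> /is_trig_mxP tN; apply/is_trig_mxP => a b ab; rewrite !mxE tN//.
have ne : (a == b) = false by rewrite -val_eqE/= ltn_eqF.
rewrite ne/=; case: (a =P i) => [<-|_] /=; rewrite ?(eq_sym b) ?ne ?subrr ?addr0//.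
Qed.

Lemma eig_mx_diag i N : eig_mx i N i i = 1.
Proof. by rewrite !mxE !eqxx/= mulr1n subrr add0r. Qed.

Lemma eig_mx_unit i N : is_trig_mx N -> (forall j, N j j = d 0 j) ->
  eig_mx i N \in unitmx.
Proof.
move=> tN dN; rewrite trig_unitmx ?eig_mx_trig//; apply/forallP => j.
have [->|ji] := eqVneq j i; first by rewrite eig_mx_diag oner_eq0.
rewrite !mxE (negbTE ji)/= addr0 eqxx mulr1n !dN subr_eq0.
by apply: contra ji => /eqP/d_inj ->.
Qed.

Lemma eigrows_unitrig N : is_trig_mx N -> (forall j, N j j = d 0 j) ->
  unitrig_mx (eigrows N).
Proof.
move=> tN dN.
have tI i : is_trig_mx (invmx (eig_mx i N)).
  by apply: invmx_trig; [exact: eig_mx_unit|exact: eig_mx_trig].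
split=> [|i].
  by apply/is_trig_mxP => i j ij; rewrite mxE; move/is_trig_mxP: (tI i) => ->.
have := congr1 (fun M : 'M_n => M i i) (mulVmx (eig_mx_unit i tN dN)).
rewrite mulmx_trig_diag ?eig_mx_trig// eig_mx_diag mulr1 [in RHS]mxE eqxx => e.
by rewrite mxE e.
Qed.

(** Consequently a row [y] with [y 0 i = 1] is a left eigenvector of [N] for [N i i] exactly when
    [eig_mx i N] sends it to the [i]-th basis row. *)
Lemma row_eig_mx i N (y : 'rV[F]_n) :
  y *m eig_mx i N = y *m N - N i i *: y + y 0 i *: delta_mx 0 i.
Proof.
rewrite mulmxDr mulmxBr mul_mx_scalar; congr (_ + _).
by apply/matrixP => a b; rewrite !mxE (bigD1 i)//= big1 => [|k ki];
  rewrite !mxE ?eqxx/= ?addr0 ?(negbTE ki)/= ?mulr0// ord1.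
Qed.

Lemma eigrowsE N : is_trig_mx N -> (forall j, N j j = d 0 j) ->
  eigrows N *m N = diag_mx d *m eigrows N.
Proof.
move=> tN dN; apply/row_matrixP => i; rewrite row_mul row_mul_diag_mx -dN.
have rE : row i (eigrows N) = row i (invmx (eig_mx i N)).
  by apply/rowP => j; rewrite !mxE.
have eK : row i (eigrows N) *m eig_mx i N = delta_mx 0 i.
  by rewrite rE -row_mul mulVmx ?row1//; exact: eig_mx_unit.
have /eqP := row_eig_mx i N (row i (eigrows N)).
rewrite eK [row _ _ _ i]mxE (eigrows_unitrig tN dN).2 scale1r.
by rewrite -subr_eq subrr eq_sym subr_eq0 -row_mul => /eqP.
Qed.

(** Row [i] of [L] is a left eigenvector with [i]-th coordinate 1, so [eig_mx i N] sends it to the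
    [i]-th basis row; invertibility then determines it. *)
Lemma eigrows_unique N L : is_trig_mx N -> (forall j, N j j = d 0 j) ->
  unitrig_mx L -> L *m N = diag_mx d *m L -> eigrows N = L.
Proof.
move=> tN dN [_ dL] e; apply/row_matrixP => i.
have rE : row i (eigrows N) = row i (invmx (eig_mx i N)).
  by apply/rowP => j; rewrite !mxE.
have := row_eig_mx i N (row i L).
rewrite -(row_mul i L N) e row_mul_diag_mx dN subrr add0r mxE dL scale1r => eL.
rewrite rE -[RHS](mulmxK (eig_mx_unit i tN dN)) eL.
by rewrite -rowE.
Qed.

End Diagonalizer.

(** * Gram matrices and orthogonalization *)

Section Gram.
Variables (C : numClosedFieldType) (n : nat).
Implicit Types A : 'M[C]_n.

Lemma mulmx_trmxC_eq0 m (z : 'rV[C]_m) : z *m z ^t* = 0 -> z = 0.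
Proof.
move=> /matrixP/(_ 0 0); rewrite !mxE => z0; apply/rowP => k; rewrite mxE.
have /psumr_eq0P : forall i, true -> 0 <= z 0 i * (z ^t*) i 0.
  by move=> i _; rewrite !mxE mul_conjC_ge0.
by move=> /(_ z0 k isT)/eqP; rewrite !mxE mul_conjC_eq0 => /eqP.
Qed.

Lemma unitmx_trmxC A : (A ^t* \in unitmx) = (A \in unitmx).
Proof. by rewrite map_unitmx unitmx_tr. Qed.

(** Positive definiteness: a left kernel vector [y] is supported on the indices at most [j], where
    [y *m (A ^t* *m A)] vanishes. Hence [y *m A ^t*] has squared norm 0. *)
Lemma gram_lead_unit A : A \in unitmx ->
  forall j, lead_mx j (A ^t* *m A) \in unitmx.
Proof.
move=> uA j; rewrite -row_free_unit -kermx_eq0; apply/rowV0P => y.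
move=> /sub_kermxP yC.
have y0 (b : 'I_n) : (j < b)%N -> y 0 b = 0.
  move=> jb; have /rowP/(_ b) := yC; rewrite !mxE (bigD1 b)//= big1 => [|c cb].
    by rewrite mxE leqNgt jb/= eqxx mulr1 addr0.
  by rewrite mxE leqNgt jb/= (negbTE cb) mulr0.
have yG (b : 'I_n) : (b <= j)%N -> (y *m (A ^t* *m A)) 0 b = 0.
  move=> bj; transitivity ((y *m lead_mx j (A ^t* *m A)) 0 b); last first.
    by rewrite yC mxE.
  rewrite [LHS]mxE [RHS]mxE; apply: eq_bigr => c _.
  by rewrite [lead_mx _ _ _ _]mxE bj.
have yA0 : y *m A ^t* = 0.
  apply: mulmx_trmxC_eq0.
  rewrite trmx_mul map_mxM/= trmxCK mulmxA -(mulmxA y).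
  apply/matrixP => a b; rewrite !ord1 mxE [RHS]mxE big1// => k _.
  have [kj|jk] := leqP k j; first by rewrite yG ?mul0r.
  by rewrite [X in _ * X](_ : _ = 0) ?mulr0// mxE mxE y0// conjC0.
have uA' : A ^t* \in unitmx by rewrite unitmx_trmxC.
by rewrite -(mulmxK uA' y) yA0 mul0mx.
Qed.

(** The Gram-Schmidt change of basis without normalization, rational in the entries of [A] and their
    conjugates: [A *m gram_inv A] has orthogonal columns. *)
Definition gram_inv A := lu_inv (A ^t* *m A).

(** With [S] the change of basis, [Q ^t* *m Q] is the product of the lower triangular matrices
    [S ^t*] and [A ^t* *m A *m S]; being Hermitian too, it is diagonal. The second factor is
    unitriangular, so the diagonal is that of [S ^t*], and it consists of nonzero squared norms. *)
Lemma gram_inv_orthogonal A : A \in unitmx ->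
  let Q := A *m gram_inv A in
  Q ^t* *m Q = diag_mx (\row_j gram_inv A j j) /\
  forall j, 0 < gram_inv A j j.
Proof.
move=> uA; set S := gram_inv A; move=> Q.
have uG := gram_lead_unit uA.
have [] : unitrig_mx ((A ^t* *m A) *m S) by exact: lu_inv_unitrig.
move=> tGS dGS.
have uS : upper_mx S by exact: lu_inv_upper.
have tS : is_trig_mx (S ^t*).
  apply/is_trig_mxP => i j ij; rewrite mxE mxE.
  by move/upper_mxP: uS => ->//; rewrite conjC0.
have QE : Q ^t* *m Q = S ^t* *m ((A ^t* *m A) *m S).
  by rewrite /Q trmx_mul map_mxM !mulmxA.
have tQ : is_trig_mx (Q ^t* *m Q) by rewrite QE mulmx_trig.
have QC : (Q ^t* *m Q) ^t* = Q ^t* *m Q by rewrite trmx_mul map_mxM trmxCK.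
have dQ j : (Q ^t* *m Q) j j = (S j j)^*.
  by rewrite QE mulmx_trig_diag// [X in _ * X]dGS mulr1 mxE mxE.
have Sgt0 j : 0 < S j j.
  have : 0 < (Q ^t* *m Q) j j.
    rewrite lt0r; apply/andP; split; last first.
      by rewrite mxE sumr_ge0// => k _; rewrite !mxE mulrC mul_conjC_ge0.
    rewrite dQ conjC_eq0; have : S \in unitmx by exact: lu_inv_unit.
    by rewrite upper_unitmx// => /forallP.
  by rewrite dQ => S0; rewrite -[S j j]conjCK geC0_conj// ltW.
split=> //; apply/matrixP => i j.
have [<-|ij] := eqVneq i j.
  by rewrite dQ [RHS]mxE eqxx mulr1n [in RHS]mxE geC0_conj//; exact/ltW.
rewrite [RHS]mxE (negbTE ij) mulr0n.
have := ij; rewrite neq_ltn => /orP[lt_ij|lt_ji].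
  by move/is_trig_mxP: tQ => ->.
rewrite -QC mxE mxE; move/is_trig_mxP: tQ => ->//; exact: conjC0.
Qed.

Lemma gram_invE A : gram_inv A = lu_inv (A ^t* *m A).
Proof. by []. Qed.

Lemma gram_inv_unit A : A \in unitmx -> gram_inv A \in unitmx.
Proof. by move=> uA; exact: lu_inv_unit (gram_lead_unit uA). Qed.

Lemma gram_inv_upper A : upper_mx (gram_inv A).
Proof. exact: lu_inv_upper. Qed.

End Gram.

(** * Smooth dependence of the factorizations *)

Section SmoothFactorizations.
Variables (R : realType) (V : normedModType R) (O : set V) (n : nat).
Hypothesis openO : open O.
Implicit Type F : V -> 'M[R[i]]_n.

Lemma mxsmooth_lead F j : mxsmooth O F -> mxsmooth O (fun x => lead_mx j (F x)).
Proof.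
move=> sF a b; have [bj|jb] := leqP b j.
  by apply: csmooth_ext (sF a b) => // x _; rewrite mxE bj.
apply: csmooth_ext (csmooth_cst openO (a == b)%:R) => // x _.
by rewrite mxE leqNgt jb.
Qed.

Lemma mxsmooth_lu_inv F : (forall x, O x -> forall j, lead_mx j (F x) \in unitmx) ->
  mxsmooth O F -> mxsmooth O (fun x => lu_inv (F x)).
Proof.
move=> uF sF b j; have [bj|jb] := leqP b j.
  have := mxsmoothV openO (fun x Ox => uF x Ox j) (mxsmooth_lead j sF) b j.
  by apply: csmooth_ext => // x _; rewrite [RHS]mxE bj.
apply: csmooth_ext (csmooth_cst openO 0) => // x _.
by rewrite mxE leqNgt jb.
Qed.

Lemma mxsmooth_eigrows F : (forall x, O x -> forall i, eig_mx i (F x) \in unitmx) ->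
  mxsmooth O F -> mxsmooth O (fun x => eigrows (F x)).
Proof.
move=> uF sF i j; have sE : mxsmooth O (fun x => eig_mx i (F x)).
  apply: mxsmoothD; [exact: openO| |exact: mxsmooth_cst].
  apply: mxsmoothD => // a b.
  have [<-|ab] := eqVneq a b.
    have sN := csmoothM openO (csmooth_cst openO (-1)) (sF i i).
    by apply: csmooth_ext sN => // x _; rewrite !mxE eqxx mulr1n mulN1r.
  apply: csmooth_ext (csmooth_cst openO 0) => // x _.
  by rewrite !mxE (negbTE ab) mulr0n oppr0.
have := mxsmoothV openO (fun x Ox => uF x Ox i) sE i j.
by apply: csmooth_ext => // x _; rewrite [RHS]mxE.
Qed.

Lemma mxsmooth_gram_inv F : (forall x, O x -> F x \in unitmx) ->
  mxsmooth O F -> mxsmooth O (fun x => gram_inv (F x)).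
Proof.
move=> uF sF; apply: mxsmooth_lu_inv.
  by move=> x Ox j; apply: gram_lead_unit; exact: uF.
by apply: mxsmoothM => //; exact: mxsmooth_trmxC.
Qed.

Lemma mxsmooth_diag (f : 'I_n -> V -> R[i]) : (forall j, csmooth O (f j)) ->
  mxsmooth O (fun x => diag_mx (\row_j f j x)).
Proof.
move=> sf a b; have [<-|ab] := eqVneq a b.
  by apply: csmooth_ext (sf a) => // x _; rewrite !mxE eqxx mulr1n.
apply: csmooth_ext (csmooth_cst openO 0) => // x _.
by rewrite !mxE (negbTE ab) mulr0n.
Qed.

End SmoothFactorizations.

(** * Charts of the unitary group *)

(* Keeps unification from comparing the entries of distinct factorizations. *)
Opaque lead_mx lu_inv gram_inv eigrows.

(** * Matrices vanishing below the staircase *)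

Section Staircase.
Variables (F : fieldType) (n : nat) (h : 'I_n -> 'I_n).
Hypothesis hess : hessenberg_function h.

Lemma hessenberg_mono (i j : 'I_n) : (i <= j)%N -> (h i <= h j)%N.
Proof.
have [_ hS] := hess; move: j => [j jn] /=; elim: j jn => [|j IH] jn ij.
  have -> // : i = Ordinal jn by apply: val_inj => /=; apply/eqP; rewrite -leqn0.
move: ij; rewrite leq_eqVlt => /orP[/eqP ij|ij].
  by have -> : i = Ordinal jn by exact: val_inj.
have jn' : (j < n)%N by exact: ltn_trans jn.
by apply: leq_trans (IH jn' _) (hS (Ordinal jn') (Ordinal jn) _).
Qed.

Definition low_staircase (A : 'M[F]_n) :=
  forall i j : 'I_n, (h j < i)%N -> A i j = 0.

Lemma low_staircase_upperM (A S : 'M[F]_n) : upper_mx S ->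
  low_staircase A -> low_staircase (S *m A).
Proof.
move=> /upper_mxP uS sA i j ij; rewrite mxE big1// => k _.
have [ki|ik] := ltnP k i; first by rewrite uS ?mul0r.
by rewrite sA ?mulr0// (leq_trans ij).
Qed.

(** Column [j] of the product combines the columns [k <= j] of [A], which vanish beyond
    [h k <= h j]; this is where monotonicity of [h] enters. *)
Lemma low_staircase_Mupper (A S : 'M[F]_n) : upper_mx S ->
  low_staircase A -> low_staircase (A *m S).
Proof.
move=> /upper_mxP uS sA i j ij; rewrite mxE big1// => k _.
have [jk|kj] := ltnP j k; first by rewrite uS ?mulr0.
by rewrite sA ?mul0r// (leq_ltn_trans (hessenberg_mono kj)).
Qed.

Lemma low_staircase_conj (A S : 'M[F]_n) : S \in unitmx -> upper_mx S ->
  low_staircase (invmx S *m A *m S) <-> low_staircase A.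
Proof.
move=> uS tS; split=> [|sA]; last first.
  apply: low_staircase_Mupper => //; apply: low_staircase_upperM => //.
  exact: invmx_upper.
move=> /(low_staircase_upperM tS)/(low_staircase_Mupper (invmx_upper uS tS)).
by rewrite -!mulmxA mulmxV// mulmx1 mulKVmx.
Qed.

End Staircase.

Lemma intertwine (F : fieldType) n (W U S D Lam : 'M[F]_n) :
  U \in unitmx -> S \in unitmx -> W *m Lam = D *m W ->
  D *m (W *m U *m S) = W *m U *m S *m (invmx S *m (invmx U *m Lam *m U) *m S).
Proof.
move=> uU uS e; rewrite !mulmxA -e (mulmxK uS); do 2!congr (_ *m _).
by rewrite (mulmxK uU).
Qed.

Lemma perm_mx_trmxC (C : numClosedFieldType) m (t : {perm 'I_m}) :
  (perm_mx t : 'M[C]_m) ^t* = invmx (perm_mx t).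
Proof.
apply: (can_inj (mulKmx (unitmx_perm C t))).
by rewrite tr_perm_mx map_perm_mx -perm_mxM mulgV perm_mx1 mulmxV ?unitmx_perm.
Qed.

Lemma perm_mx_unitary (C : numClosedFieldType) m (t : {perm 'I_m}) :
  (perm_mx t : 'M[C]_m) \is unitarymx.
Proof. by apply/unitarymxP; rewrite perm_mx_trmxC mulmxV// unitmx_perm. Qed.

(** * A chart on a big cell and its inverse *)

Section Chart.
Variables (R : realType) (n : nat) (lam : 'I_n -> R) (s : {perm 'I_n}).
Variable theta : 'I_n -> R[i].
Hypothesis lam_inj : injective lam.
Hypothesis theta_neq0 : forall j, theta j != 0.

Let W : 'M[R[i]]_n := perm_mx s.
Let d : 'rV[R[i]]_n := \row_j ((lam (s j))%:C)%C.

Lemma perm_Lambda : W *m Lambda_mx lam = diag_mx d *m W.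
Proof.
apply/matrixP => i j; rewrite mul_diag_mx -row_permE !mxE.
by case: (s i == j); rewrite ?mulr1n ?mulr0n ?mulr1 ?mulr0.
Qed.

Lemma d_inj i j : d 0 i = d 0 j -> i = j.
Proof. by rewrite !mxE => /complexI/lam_inj/perm_inj. Qed.

Definition chart_upper U := lu_inv (W *m U).
Definition chart_lower U := W *m U *m chart_upper U.
Definition chart_coord U := invmx (chart_lower U) *m diag_mx d *m chart_lower U.

Definition lead_unit U := forall j, lead_mx j (W *m U) \in unitmx.

(** The reference phases [theta] turn the diagonal of [chart_upper] into the right half-plane, where
    an argument is determined by its slope. *)
Definition chart_dom U := lead_unit U /\
  forall j, 0 < complex.Re (chart_upper U j j * theta j).

Lemma chart_coord_trig U : lead_unit U ->
  is_trig_mx (chart_coord U) /\ forall j, chart_coord U j j = d 0 j.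
Proof.
move=> uU; have uL : unitrig_mx (chart_lower U) by exact: lu_inv_unitrig.
have [tL dL] := uL; have [tI dI] := unitrig_inv uL.
have tID : is_trig_mx (invmx (chart_lower U) *m diag_mx d).
  by rewrite mulmx_trig// diag_mx_is_trig.
split=> [|j]; first by rewrite mulmx_trig.
rewrite mulmx_trig_diag// mulmx_trig_diag ?diag_mx_is_trig//.
by rewrite dL dI mulr1 mul1r mxE eqxx.
Qed.

(** By [intertwine], the coordinate matrix is a conjugate of [invmx U *m Lambda_mx lam *m U] by an
    upper triangular matrix, so both satisfy the same staircase conditions. *)
Lemma chart_coordE U : lead_unit U -> U \in unitmx -> chart_coord U =
  invmx (chart_upper U) *m (invmx U *m Lambda_mx lam *m U) *m chart_upper U.
Proof.
move=> lU uU; have uS : chart_upper U \in unitmx by exact: lu_inv_unit.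
have uL : chart_lower U \in unitmx.
  exact/unitrig_unitmx/lu_inv_unitrig.
have := intertwine uU uS perm_Lambda; rewrite -[W *m U *m _]/(chart_lower U).
by move=> e; rewrite /chart_coord -mulmxA e mulKmx.
Qed.

(* The diagonal stores the slopes of the arguments of the diagonal of
   chart_upper; the real and imaginary parts of the entry (i, j) of chart_coord,
   j < i, are stored at (i, j) and (j, i) respectively. *)
Definition chart_phi U : 'M[R]_n := \matrix_(i, j)
  if i == j then
    - complex.Im (chart_upper U i i * theta i) /
      complex.Re (chart_upper U i i * theta i)
  else if (j < i)%N then complex.Re (chart_coord U i j)
  else complex.Im (chart_coord U j i).

Definition low_mx (X : 'M[R]_n) : 'M[R[i]]_n := \matrix_(i, j)
  if i == j then d 0 i else if (j < i)%N then (X i j +i* X j i)%C else 0.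

(** For [X = chart_phi U] with [U] in the chart domain, this is a positive multiple of the conjugate
    of [chart_upper U j j]. *)
Definition phase (X : 'M[R]_n) j : R[i] := (1 +i* X j j)%C * theta j.

(* The scalar multiplying the j-th orthogonalised column: it has the argument
   of phase X j, and normalises the column, whose squared norm is g. *)
Definition scaling (X : 'M[R]_n) (g : R[i]) j : R[i] :=
  phase X j * ((Num.sqrt ((complex.Re (phase X j) ^+ 2 +
    complex.Im (phase X j) ^+ 2) * complex.Re g))^-1)%:C%C.

(** The entry [gram_inv L j j] passed to [scaling] is the squared norm of column [j] of
    [L *m gram_inv L]. *)
Definition chart_psi (X : 'M[R]_n) : 'M[R[i]]_n :=
  let L := eigrows (low_mx X) in
  invmx W *m (L *m gram_inv L) *m
    diag_mx (\row_j scaling X (gram_inv L j j) j).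

Lemma low_mx_trig X : is_trig_mx (low_mx X) /\ forall j, low_mx X j j = d 0 j.
Proof.
split=> [|j]; last by rewrite mxE eqxx.
apply/is_trig_mxP => i j ij; rewrite mxE.
by rewrite -val_eqE/= (ltn_eqF ij) ltnNge (ltnW ij).
Qed.

Lemma phase_neq0 X j : phase X j != 0.
Proof.
by rewrite mulf_neq0// eq_complex/= negb_and oner_eq0.
Qed.

Lemma scaling_pos X g j : 0 < g ->
  exists2 c : R, 0 < c & scaling X g j = phase X j * (c%:C)%C.
Proof.
rewrite ltcE/= => /andP[_ g0]; eexists; last by [].
by rewrite invr_gt0 sqrtr_gt0 mulr_gt0// sqr_Re_Im_gt0 phase_neq0.
Qed.

Lemma normC2 (z : R[i]) :
  z * z^* = ((complex.Re z ^+ 2 + complex.Im z ^+ 2)%:C)%C.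
Proof. by rewrite add_Re2_Im2 -normCK. Qed.

Lemma scaling_norm X g j : 0 < g -> scaling X g j * (scaling X g j)^* * g = 1.
Proof.
move=> g0; have := g0; rewrite ltcE/= => /andP[/eqP Img Reg].
have gE : g = ((complex.Re g)%:C)%C by rewrite [LHS]complexE Img mulr0 addr0.
rewrite /scaling; set v := phase X j; set q := (_ * complex.Re g).
have q0 : 0 < q by rewrite mulr_gt0// sqr_Re_Im_gt0 phase_neq0.
rewrite rmorphM /= mulrACA normC2 [((_)^-1%:C)%C^*]conjc_real -rmorphM/=.
rewrite {1}gE -!rmorphM/= -invfM -expr2 sqr_sqrtr ?ltW//.
by rewrite mulrAC mulfV// gt_eqF.
Qed.

Lemma slope_inv (r x : R) : 0 < r ->
  let z := ((r%:C)%C * (1 +i* x)%C)^-1 in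
  0 < complex.Re z /\ - complex.Im z / complex.Re z = x.
Proof.
move=> r0 z; have q0 : 0 < r ^+ 2 + (r * x) ^+ 2.
  by rewrite ltr_wpDr ?sqr_ge0// exprn_gt0.
have Rz : complex.Re z = r / (r ^+ 2 + (r * x) ^+ 2).
  by rewrite Re_invc Re_mulc Im_mulc/= !mul0r mulr1 subr0 addr0.
have Iz : complex.Im z = - (r * x / (r ^+ 2 + (r * x) ^+ 2)).
  by rewrite Im_invc Re_mulc Im_mulc/= !mul0r mulr1 subr0 addr0.
rewrite Rz Iz divr_gt0//; split=> //.
by field; rewrite !gt_eqF.
Qed.

Let L X := eigrows (low_mx X).
Let T X := gram_inv (L X) *m
  diag_mx (\row_j scaling X (gram_inv (L X) j j) j).

Lemma eigrows_low_unitrig X : unitrig_mx (L X).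
Proof. by have [tN dN] := low_mx_trig X; exact: (eigrows_unitrig d_inj tN dN). Qed.

Lemma scaling_neq0 X g j : 0 < g -> scaling X g j != 0.
Proof.
move=> /(scaling_norm X j) e; apply/eqP => s0; move: e.
by rewrite s0 !mul0r => /eqP; rewrite eq_sym oner_eq0.
Qed.

(** This exhibits the triangular factorization of [W *m chart_psi X]; by uniqueness, [chart_upper]
    and [chart_lower] of [chart_psi X] are [invmx (T X)] and [L X]. *)
Lemma chart_psi_split X :
  [/\ W *m chart_psi X = L X *m T X, upper_mx (T X) & T X \in unitmx].
Proof.
have uL := unitrig_unitmx (eigrows_low_unitrig X).
have [_ g0] := gram_inv_orthogonal uL.
have uT : upper_mx (T X).
  by apply: mulmx_upper; [exact: gram_inv_upper|exact: diag_mx_upper].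
split; [|exact: uT|].
  rewrite /chart_psi -mulmxA (mulKVmx (unitmx_perm _ s)) -mulmxA; reflexivity.
rewrite unitmx_mul (gram_inv_unit uL)/=.
rewrite upper_unitmx ?diag_mx_upper//; apply/forallP => j.
by rewrite [diag_mx _ _ _]mxE eqxx mulr1n [X in X != 0]mxE scaling_neq0.
Qed.

Lemma chart_psi_upper X : chart_upper (chart_psi X) = invmx (T X).
Proof.
have [e uT TU] := chart_psi_split X.
apply: lu_inv_unique; first exact: invmx_upper.
by rewrite e (mulmxK TU); exact: eigrows_low_unitrig.
Qed.

Lemma chart_psi_coord X : chart_coord (chart_psi X) = low_mx X.
Proof.
have [e uT TU] := chart_psi_split X; have [tN dN] := low_mx_trig X.
have uL := unitrig_unitmx (eigrows_low_unitrig X).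
have eL : chart_lower (chart_psi X) = L X.
  by rewrite /chart_lower chart_psi_upper e (mulmxK TU).
by rewrite /chart_coord eL -mulmxA -(eigrowsE d_inj tN dN) mulKmx.
Qed.

Lemma chart_psi_slope X j : let z := chart_upper (chart_psi X) j j * theta j in
  0 < complex.Re z /\ - complex.Im z / complex.Re z = X j j.
Proof.
have uL := unitrig_unitmx (eigrows_low_unitrig X).
have [_ g0] := gram_inv_orthogonal uL.
have [e uT TU] := chart_psi_split X.
have gj := g0 j; have := gj; rewrite ltcE/= => /andP[/eqP Img Reg].
have [c c0 cE] := scaling_pos X j gj.
(* The diagonal entry of [T X] is a positive number times [(1 +i* X j j) * theta j]; after inversion
   the factor [theta j] cancels. *)
have -> : chart_upper (chart_psi X) j j * theta j =
    (((complex.Re (gram_inv (L X) j j) * c)%:C)%C * (1 +i* X j j)%C)^-1.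
  rewrite chart_psi_upper (invmx_upper_diag j TU uT) /T.
  rewrite (mulmx_upper_diag j (gram_inv_upper _) (diag_mx_upper _)).
  rewrite [diag_mx _ _ _]mxE eqxx mulr1n [(\row_ _ _) _ _]mxE cE /phase.
  have -> : gram_inv (L X) j j = ((complex.Re (gram_inv (L X) j j))%:C)%C.
    by rewrite [LHS]complexE Img mulr0 addr0.
  move: (complex.Re _) (1 +i* _)%C => g' z; rewrite rmorphM/=.
  rewrite (_ : _ * (_ * _ * _) = (g'%:C)%C * (c%:C)%C * z * theta j); last by ring.
  by rewrite invfM divfK.
by apply: slope_inv; rewrite mulr_gt0.
Qed.

Lemma chart_psi_dom X : chart_dom (chart_psi X).
Proof.
have [e uT TU] := chart_psi_split X; split=> [|j].
  apply: (lead_mx_unit (invmx_upper TU uT)).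
  by rewrite e (mulmxK TU); exact: eigrows_low_unitrig.
by have [] := chart_psi_slope X j.
Qed.

Lemma chart_psi_unitary X : chart_psi X \is unitarymx.
Proof.
have uL := unitrig_unitmx (eigrows_low_unitrig X).
have [QQ g0] := gram_inv_orthogonal uL.
rewrite /chart_psi -(mulmxA (invmx W)) mul_unitarymx//.
  by rewrite -perm_mx_trmxC trmxC_unitary perm_mx_unitary.
(* The columns are orthonormal: the Gram matrix of the orthogonalized columns is diagonal, and
   [scaling] normalizes each diagonal entry to 1. *)
rewrite -trmxC_unitary; apply/unitarymxP; rewrite trmxCK trmx_mul map_mxM.
rewrite mulmxA -(mulmxA _ (_ ^t*)) QQ tr_diag_mx map_diag_mx !mulmx_diag.
apply/matrixP => i j; rewrite mxE [RHS]mxE; case: eqP => // _; congr (_ *+ _).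
rewrite mxE [X in X * _]mxE [X in X * _ * _]mxE [X in X^* * _ * _]mxE.
rewrite [X in _ * X * _]mxE [X in _ * X]mxE mulrC mulrA.
exact: scaling_norm.
Qed.

Lemma chart_psiK X : chart_phi (chart_psi X) = X.
Proof.
apply/matrixP => i j; rewrite mxE; have [<-|ij] := eqVneq i j.
  by have [_] := chart_psi_slope X i.
rewrite chart_psi_coord; case: ltnP => ji; rewrite mxE ?(negbTE ij).
  by rewrite ji.
by rewrite eq_sym (negbTE ij) ltn_neqAle ij ji.
Qed.

Lemma slope_conj (w : R[i]) : 0 < complex.Re w ->
  (1 +i* (- complex.Im w / complex.Re w))%C = ((complex.Re w)^-1%:C)%C * w^*.
Proof.
case: w => u v /= u0; apply/eqP; rewrite eq_complex/= mul0r oppr0 addr0.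
by rewrite (mulVf (lt0r_neq0 u0)) eqxx mul0r addr0/= mulrC.
Qed.

(** Here [a] is a diagonal entry of [chart_upper]. The slope makes [phase X j] a positive multiple
    [r] of [a^*], and the normalizing square root equals [r]. *)
Lemma scaling_slope (X : 'M[R]_n) (a : R[i]) j : 0 < complex.Re (a * theta j) ->
  X j j = - complex.Im (a * theta j) / complex.Re (a * theta j) ->
  scaling X (a^-1 * (a^*)^-1) j = a^*.
Proof.
move=> sigma0 Xj; set t := theta j in sigma0 Xj.
have a0 : a != 0 by apply: contraL sigma0 => /eqP ->; rewrite mul0r ltxx.
have na0 : 0 < complex.Re a ^+ 2 + complex.Im a ^+ 2 by rewrite sqr_Re_Im_gt0.
pose r := (complex.Re t ^+ 2 + complex.Im t ^+ 2) / complex.Re (a * t).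
have r0 : 0 < r by rewrite divr_gt0// sqr_Re_Im_gt0 theta_neq0.
have phE : phase X j = (r%:C)%C * a^*.
  have e : (1 +i* X j j)%C = ((complex.Re (a * t))^-1%:C)%C * (a * t)^*.
    by rewrite Xj slope_conj.
  rewrite /phase e -/t rmorphM/= /r rmorphM/= -normC2; ring.
have gE : complex.Re (a^-1 * (a^*)^-1) =
    (complex.Re a ^+ 2 + complex.Im a ^+ 2)^-1.
  rewrite -invfM normC2 Re_invc/= expr0n addr0 expr2 invfM mulrA.
  by rewrite mulfV ?mul1r// gt_eqF.
rewrite /scaling gE phE; set q := Num.sqrt _.
have -> : q = r.
  rewrite /q Re_mulc Im_mulc Re_conjC Im_conjC/= !mul0r subr0 addr0.
  rewrite (_ : _ / _ = r ^+ 2) ?sqrtr_sqr ?ger0_norm ?ltW//.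
  by field; rewrite gt_eqF.
by rewrite mulrAC -rmorphM/= mulfV ?mul1r// gt_eqF.
Qed.

Lemma low_mx_phi U : lead_unit U -> low_mx (chart_phi U) = chart_coord U.
Proof.
move=> lU; have [/is_trig_mxP tN dN] := chart_coord_trig lU.
apply/matrixP => i j; rewrite mxE; have [<-|ij] := eqVneq i j; first by rewrite dN.
case: ltnP => ji; last by rewrite tN// ltn_neqAle ij ji.
have -> : chart_phi U i j = complex.Re (chart_coord U i j).
  by rewrite mxE (negbTE ij) ji.
have -> : chart_phi U j i = complex.Im (chart_coord U i j).
  by rewrite mxE eq_sym (negbTE ij) ltnNge (ltnW ji).
by case: (chart_coord U i j).
Qed.

(** Since [W *m U] is unitary, the Gram matrix of [chart_lower U] is [S ^t* *m S] with
    [S = chart_upper U]. Multiplied by the right-hand side it gives [S ^t*] with its diagonal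
    rescaled to 1, so uniqueness applies. *)
Lemma gram_inv_lower U : U \is unitarymx -> lead_unit U ->
  gram_inv (chart_lower U) =
  invmx (chart_upper U) *m diag_mx (\row_j ((chart_upper U j j)^*)^-1).
Proof.
move=> Uu lU; have uS : chart_upper U \in unitmx by exact: lu_inv_unit.
have tS : upper_mx (chart_upper U) by exact: lu_inv_upper.
have WUu : W *m U \is unitarymx by exact: (mul_unitarymx (perm_mx_unitary _ s) Uu).
have GE : (chart_lower U) ^t* *m chart_lower U =
    (chart_upper U) ^t* *m chart_upper U.
  rewrite /chart_lower trmx_mul map_mxM -mulmxA (mulmxA _ _ (chart_upper U)).
  by rewrite -(invmx_unitary WUu) (mulVmx (unitarymx_unit WUu)) mul1mx.
have tSC : is_trig_mx ((chart_upper U) ^t*).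
  by apply/is_trig_mxP => i j ij; rewrite mxE mxE; move/upper_mxP: tS => ->//;
    rewrite conjC0.
rewrite gram_invE; apply: lu_inv_unique.
  exact: (mulmx_upper (invmx_upper uS tS) (diag_mx_upper _)).
rewrite GE mulmxA (mulmxK uS); split=> [|i].
  exact: (mulmx_trig tSC (diag_mx_is_trig _)).
rewrite (mulmx_trig_diag i tSC (diag_mx_is_trig _)) [diag_mx _ _ _]mxE eqxx mulr1n.
rewrite mxE mxE [X in _ * X]mxE mulfV// conjC_eq0.
by move: uS; rewrite upper_unitmx// => /forallP.
Qed.

Lemma chart_phiK U : U \is unitarymx -> chart_dom U ->
  chart_psi (chart_phi U) = U.
Proof.
move=> Uu [lU sigma0]; have uS : chart_upper U \in unitmx by exact: lu_inv_unit.
have tS : upper_mx (chart_upper U) by exact: lu_inv_upper.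
have [tN dN] := chart_coord_trig lU.
have uL : unitrig_mx (chart_lower U) by exact: lu_inv_unitrig.
have LE : eigrows (low_mx (chart_phi U)) = chart_lower U.
  rewrite low_mx_phi//; apply: (eigrows_unique d_inj tN dN uL).
  by rewrite /chart_coord -mulmxA (mulKVmx (unitrig_unitmx uL)).
rewrite /chart_psi LE.
have gE j : gram_inv (chart_lower U) j j =
    (chart_upper U j j)^-1 * ((chart_upper U j j)^*)^-1.
  rewrite (gram_inv_lower Uu lU).
  rewrite (mulmx_upper_diag j (invmx_upper uS tS) (diag_mx_upper _)).
  by rewrite (invmx_upper_diag j uS tS) [diag_mx _ _ _]mxE eqxx mulr1n [X in _ * X]mxE.
have S0 j : chart_upper U j j != 0.
  by move: uS; rewrite upper_unitmx// => /forallP.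
have -> : (\row_j scaling (chart_phi U) (gram_inv (chart_lower U) j j) j) =
    \row_j (chart_upper U j j)^*.
  apply/rowP => j; rewrite [LHS]mxE [RHS]mxE.
  apply: (eq_trans (congr1 (fun z => scaling (chart_phi U) z j) (gE j))).
  by apply: scaling_slope; [exact: sigma0|rewrite mxE eqxx].
(* The scaling undoes the diagonal factor of [gram_inv_lower], leaving [invmx W *m chart_lower U *m
   invmx (chart_upper U)], which is [U]. *)
have DE : diag_mx (\row_j ((chart_upper U j j)^*)^-1) *m
    diag_mx (\row_j (chart_upper U j j)^*) = 1%:M.
  rewrite mulmx_diag; apply/matrixP => i j; rewrite mxE [RHS]mxE; congr (_ *+ _).
  by rewrite mxE [X in X * _]mxE [X in _ * X]mxE mulVf// conjC_eq0.
rewrite (gram_inv_lower Uu lU) -!mulmxA DE.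
rewrite mulmx1 /chart_lower !mulmxA (mulmxK uS).
by rewrite (mulVmx (unitmx_perm _ s)) mul1mx.
Qed.

End Chart.

(** * Smoothness of the chart and of its inverse *)

Section ChartSmooth.
Variables (R : realType) (n : nat) (lam : 'I_n -> R) (s : {perm 'I_n}).
Variable theta : 'I_n -> R[i].
Hypothesis lam_inj : injective lam.
Hypothesis theta_neq0 : forall j, theta j != 0.
Variables (V : normedModType R) (O : set V).
Hypothesis openO : open O.

Lemma mxsmooth_chart_upper (U : V -> 'M[R[i]]_n) :
  (forall x, O x -> lead_unit s (U x)) -> mxsmooth O U ->
  mxsmooth O (fun x => chart_upper s (U x)).
Proof.
move=> dU sU; apply: mxsmooth_lu_inv => //.
by apply: mxsmoothM => //; exact: mxsmooth_cst.
Qed.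

Lemma csmooth_chart_sigma (U : V -> 'M[R[i]]_n) j :
  (forall x, O x -> lead_unit s (U x)) -> mxsmooth O U ->
  csmooth O (fun x => chart_upper s (U x) j j * theta j).
Proof.
move=> dU sU; apply: csmoothM => //; last exact: csmooth_cst.
exact: mxsmooth_chart_upper.
Qed.

Lemma smooth_chart_phi (U : V -> 'M[R[i]]_n) i j :
  (forall x, O x -> chart_dom s theta (U x)) -> mxsmooth O U ->
  smooth_fun O (fun x => chart_phi lam s theta (U x) i j).
Proof.
move=> dU sU; have lU x (Ox : O x) : lead_unit s (U x) := (dU x Ox).1.
have sC : mxsmooth O (fun x => chart_coord lam s (U x)).
  have sL : mxsmooth O (fun x => chart_lower s (U x)).
    apply: mxsmoothM => //; last exact: mxsmooth_chart_upper.
    by apply: mxsmoothM => //; exact: mxsmooth_cst.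
  have sLi : mxsmooth O (fun x => invmx (chart_lower s (U x))).
    apply: mxsmoothV => // x Ox.
    exact: (unitrig_unitmx (lu_inv_unitrig (lU x Ox))).
  exact: (mxsmoothM openO (mxsmoothM openO sLi (mxsmooth_cst openO _)) sL).
have [<-|ij] := eqVneq i j.
  have [sr si] := csmooth_chart_sigma i lU sU.
  have r0 x (Ox : O x) := lt0r_neq0 ((dU x Ox).2 i).
  move=> k; have := CkM openO (smoothN openO si k) (CkV openO r0 (sr k)).
  by apply: Ck_ext => // x _; rewrite [RHS]mxE eqxx.
have [ji|] := ltnP j i.
  by apply: smooth_ext (sC i j).1 => // x _; rewrite [RHS]mxE (negbTE ij) ji.
rewrite leqNgt => /negbTE ji.
by apply: smooth_ext (sC j i).2 => // x _; rewrite [RHS]mxE (negbTE ij) ji.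
Qed.

Lemma smooth_chart_psi (X : V -> 'M[R]_n) :
  (forall i j, smooth_fun O (fun x => X x i j)) ->
  mxsmooth O (fun x => chart_psi lam s theta (X x)).
Proof.
move=> sX; have sN : mxsmooth O (fun x => low_mx lam s (X x)).
  move=> i j; have [<-|ij] := eqVneq i j.
    apply: csmooth_ext (csmooth_cst openO ((lam (s i))%:C)%C) => // x _.
    by rewrite [RHS]mxE eqxx mxE.
  have [ji|] := ltnP j i; last rewrite leqNgt => /negbTE ji.
    split; [apply: smooth_ext (sX i j)|apply: smooth_ext (sX j i)] => // x _;
    by rewrite [low_mx _ _ _ _ _]mxE (negbTE ij) ji.
  apply: csmooth_ext (csmooth_cst openO 0) => // x _.
  by rewrite [RHS]mxE (negbTE ij) ji.
have sL : mxsmooth O (fun x => eigrows (low_mx lam s (X x))).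
  apply: mxsmooth_eigrows => // x Ox i.
  have [tN dN] := low_mx_trig lam s (X x).
  exact: (eig_mx_unit (d_inj lam_inj) i tN dN).
have uL x : eigrows (low_mx lam s (X x)) \in unitmx.
  exact: unitrig_unitmx (eigrows_low_unitrig s lam_inj (X x)).
have sg := mxsmooth_gram_inv openO (fun x _ => uL x) sL.
have g0 x j := (gram_inv_orthogonal (uL x)).2 j.
have sphase j : csmooth O (fun x => phase theta (X x) j).
  apply: csmoothM => //; last exact: csmooth_cst.
  by split=> [k|]; [exact: Ck_cst|exact: sX].
apply: mxsmoothM => //; first apply: mxsmoothM => //.
- exact: mxsmooth_cst.
- exact: mxsmoothM.
apply: mxsmooth_diag => // j; apply: csmoothM => //; apply: csmooth_real => // k.
have q0 x : O x -> 0 < (complex.Re (phase theta (X x) j) ^+ 2 +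
    complex.Im (phase theta (X x) j) ^+ 2) *
    complex.Re (gram_inv (eigrows (low_mx lam s (X x))) j j).
  move=> Ox; rewrite mulr_gt0//; last first.
    by have := g0 x j; rewrite ltcE/= => /andP[].
  by rewrite sqr_Re_Im_gt0 phase_neq0.
apply: CkV => //; first by move=> x Ox; rewrite gt_eqF// sqrtr_gt0 q0.
apply: Ck_sqrt => //.
exact: (CkM openO (smooth_sqnorm openO (sphase j) k) ((sg j j).1 k)).
Qed.

End ChartSmooth.

(** * Matrices as row vectors, free positions first *)

Section Coordinates.
Variables (R : realType) (n : nat) (c : pred ('I_n * 'I_n)).

(* The constrained positions come last, as required by coord_subspace. *)
Definition positions : seq ('I_n * 'I_n) :=
  [seq p <- index_enum ('I_n * 'I_n)%type | ~~ c p] ++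
  [seq p <- index_enum ('I_n * 'I_n)%type | c p].

Definition free_rank := size [seq p <- index_enum ('I_n * 'I_n)%type | ~~ c p].

Lemma mem_positions p : p \in positions.
Proof. by rewrite mem_cat !mem_filter mem_index_enum !andbT orNb. Qed.

Lemma uniq_positions : uniq positions.
Proof.
rewrite cat_uniq !filter_uniq ?index_enum_uniq//= andbT.
by apply/hasPn => p; rewrite !mem_filter => /andP[cp _]; rewrite /= cp.
Qed.

Lemma position_index p : (index p positions < size positions)%N.
Proof. by rewrite index_mem mem_positions. Qed.

Definition enc_mx (X : 'M[R]_n) : 'rV[R]_(size positions) :=
  \row_i X (tnth (in_tuple positions) i).1 (tnth (in_tuple positions) i).2.

Definition dec_mx (x : 'rV[R]_(size positions)) : 'M[R]_n :=
  \matrix_(i, j) x 0 (Ordinal (position_index (i, j))).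

Lemma enc_mxK X : dec_mx (enc_mx X) = X.
Proof.
apply/matrixP => i j; rewrite !mxE.
by rewrite (tnth_nth (i, j))/= nth_index ?mem_positions.
Qed.

Lemma dec_mx_tnth x i : dec_mx x (tnth (in_tuple positions) i).1
  (tnth (in_tuple positions) i).2 = x 0 i.
Proof.
rewrite mxE; congr (x 0 _); apply: val_inj => /=; rewrite -surjective_pairing.
rewrite (tnth_nth (tnth (in_tuple positions) i)) index_uniq//.
exact: uniq_positions.
Qed.

Lemma dec_mxK x : enc_mx (dec_mx x) = x.
Proof. by apply/rowP => i; rewrite mxE dec_mx_tnth. Qed.

Lemma coord_subspaceP x : coord_subspace free_rank x <->
  forall i j, c (i, j) -> dec_mx x i j = 0.
Proof.
split=> [x0 i j cij|x0 k fk].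
  rewrite mxE; apply: x0 => /=.
  by rewrite index_cat mem_filter cij/= leq_addr.
rewrite -dec_mx_tnth; apply: x0; rewrite -surjective_pairing.
set p := tnth _ _; have : p \in [seq p <- index_enum ('I_n * 'I_n)%type | c p].
  rewrite /p (tnth_nth p)/= nth_cat ltnNge [X in ~~ X]fk/=.
  apply: mem_nth; rewrite ltn_subLR// -size_cat.
  exact: (ltn_ord k).
by rewrite mem_filter => /andP[].
Qed.

End Coordinates.

(** * Passage between complex matrices and pairs of real matrices *)

Section Realification.
Variables (R : realType) (n : nat).
Local Notation V := ('M[R]_n * 'M[R]_n)%type.

Definition complexify (p : V) : 'M[R[i]]_n :=
  \matrix_(i, j) (p.1 i j +i* p.2 i j)%C.

Lemma realifyK (A : 'M[R[i]]_n) : complexify (realify A) = A.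
Proof. by apply/matrixP => i j; rewrite !mxE; case: (A i j). Qed.

Lemma smooth_entry (W : normedModType R) (O : set W) m k
    (f : W -> 'M[R]_(m, k)) i j :
  open O -> linear f -> continuous f -> smooth_fun O (fun x => f x i j).
Proof.
move=> openO lf cf l.
have lin : linear (fun x => f x i j : R).
  by move=> a x y; rewrite lf !mxE.
pose fM := GRing.isLinear.Build _ _ _ _ _ lin.
pose fL : {linear W -> R} := HB.pack (fun x => f x i j) fM.
apply: (@Ck_linear R W O openO R l fL) => x.
apply: (@continuous_comp _ _ _ f (fun M : 'M[R]_(m, k) => M i j)).
  exact: cf.
exact: coord_continuous.
Qed.

Lemma mxsmooth_complexify (O : set V) : open O -> mxsmooth O complexify.
Proof.
move=> openO i j; split.
  apply: smooth_ext (smooth_entry (f := fst) i j openO _ _) => //.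
  - by move=> x _; rewrite mxE.
  - by move=> x; exact: cvg_fst.
apply: smooth_ext (smooth_entry (f := snd) i j openO _ _) => //.
- by move=> x _; rewrite mxE.
- by move=> x; exact: cvg_snd.
Qed.

Lemma smooth_realify (W : normedModType R) (O : set W) (F : W -> 'M[R[i]]_n) :
  open O -> mxsmooth O F -> smooth_fun O (fun x => realify (F x)).
Proof.
move=> openO sF; apply: smooth_fun_pair => //; apply: smooth_fun_mx => // i j.
  by apply: smooth_ext (sF i j).1 => // x _; rewrite mxE.
by apply: smooth_ext (sF i j).2 => // x _; rewrite mxE.
Qed.

End Realification.

(** * The submanifold of the unitary group *)

Section Submanifold.
Variables (R : realType) (n : nat) (h : 'I_n -> 'I_n) (lam : 'I_n -> R).
Hypothesis hess : hessenberg_function h.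
Hypothesis lam_inj : injective lam.

Definition staircase_frames : set 'M[R[i]]_n :=
  [set U | U \is unitarymx /\ low_staircase h (invmx U *m Lambda_mx lam *m U)].

(** Symmetric in the two indices because each complex entry below the staircase occupies two mirror
    positions, one for its real and one for its imaginary part. *)
Definition constrained : pred ('I_n * 'I_n) :=
  [pred p : 'I_n * 'I_n | (h p.2 < p.1)%N || (h p.1 < p.2)%N].

(** Conjugation by [chart_upper s U] turns the condition into the vanishing of entries of
    [chart_coord]. Since [j <= h j], these lie strictly below the diagonal, so the slopes stay
    free. *)
Lemma staircase_frames_chart s theta U : U \is unitarymx -> lead_unit s U ->
  low_staircase h (invmx U *m Lambda_mx lam *m U) <->
  forall i j, constrained (i, j) -> chart_phi lam s theta U i j = 0.
Proof.
move=> Uu lU; have h_ge := hess.1.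
have uS : chart_upper s U \in unitmx by exact: lu_inv_unit.
have tS : upper_mx (chart_upper s U) by exact: lu_inv_upper.
have := low_staircase_conj hess (invmx U *m Lambda_mx lam *m U) uS tS.
rewrite -(chart_coordE lam lU (unitarymx_unit Uu)) => <-.
split=> [sC i j /orP[/=hij|/=hij]|sC i j hij].
- have ji : (j < i)%N by exact: leq_ltn_trans (h_ge j) hij.
  by rewrite mxE -val_eqE/= gtn_eqF// ji sC.
- have ij : (i < j)%N by exact: leq_ltn_trans (h_ge i) hij.
  by rewrite mxE -val_eqE/= ltn_eqF// ltnNge (ltnW ij)/= sC.
have ji : (j < i)%N by exact: leq_ltn_trans (h_ge j) hij.
have := sC i j; rewrite /constrained/= hij => /(_ isT).
rewrite mxE -val_eqE/= gtn_eqF// ji => Re0.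
have := sC j i; rewrite /constrained/= hij orbT => /(_ isT).
rewrite mxE -val_eqE/= ltn_eqF// ltnNge (ltnW ji)/= => Im0.
by apply/eqP; rewrite eq_complex Re0 Im0 eqxx.
Qed.

(** Invertibility of finitely many matrices, written as positivity of the squared moduli of their
    determinants. *)
Lemma open_lead_unit s :
  open [set p : 'M[R]_n * 'M[R]_n | lead_unit s (complexify p)].
Proof.
have sC := mxsmooth_complexify (@openT ('M[R]_n * 'M[R]_n)%type).
have sW := mxsmoothM openT (mxsmooth_cst openT (perm_mx s)) sC.
have sL j := mxsmooth_lead openT j sW.
have sD j := smooth_sqnorm openT (csmooth_det openT (sL j)).
have := open_posI openT sD; rewrite setTI; congr (open _).
apply/seteqP; split=> p /= hp j; move: (hp j);
  by rewrite sqr_Re_Im_gt0 unitmxE unitfE.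
Qed.

Lemma open_chart_dom s theta :
  open [set p : 'M[R]_n * 'M[R]_n | chart_dom s theta (complexify p)].
Proof.
have oL := @open_lead_unit s.
have sC := mxsmooth_complexify oL.
have sS j := (csmooth_chart_sigma theta oL j (fun p hp => hp) sC).1.
exact: (open_posI oL sS).
Qed.

Lemma staircase_frames_submanifold :
  smooth_mx_submanifold (@unitary_group R n) staircase_frames.
Proof.
split=> [_ [U [Uu _] <-]|]; first by exists U.
exists (size (positions constrained)), (free_rank constrained); split.
  by rewrite size_cat leq_addr.
move=> _ [U0 [U0u U0s] <-].
have [s lead0] := lead_mx_exists (unitarymx_unit U0u).
(* With this choice the products tested in [chart_dom] all equal 1 at [U0]. *)
pose theta j := (chart_upper s U0 j j)^-1.
have S0 j : chart_upper s U0 j j != 0.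
  have : chart_upper s U0 \in unitmx by exact: lu_inv_unit.
  by rewrite upper_unitmx ?lu_inv_upper// => /forallP.
have theta0 j : theta j != 0 by rewrite invr_neq0.
pose O := [set p : 'M[R]_n * 'M[R]_n | chart_dom s theta (complexify p)].
have oO : open O by exact: open_chart_dom.
pose phi p := enc_mx constrained (chart_phi lam s theta (complexify p)).
pose psi x := realify (chart_psi lam s theta (dec_mx (c := constrained) x)).
have OE U : O (realify U) = chart_dom s theta U by rewrite /O/= realifyK.
have Op0 : O (realify U0).
  by rewrite OE; split=> // j; rewrite /theta mulfV// ltr01.
have phiK U : U \is unitarymx -> chart_dom s theta U ->
    psi (phi (realify U)) = realify U.
  by move=> Uu Ud; rewrite /psi /phi enc_mxK realifyK chart_phiK.
have psiK x : phi (psi x) = x.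
  by rewrite /phi /psi realifyK chart_psiK// dec_mxK.
have psi_dom x : O (psi x) by rewrite OE; exact: chart_psi_dom.
have psi_u x : exists2 U, U \is unitarymx & psi x = realify U.
  by eexists; first exact: (chart_psi_unitary s lam_inj theta0 (dec_mx x)).
have phi_frames U : U \is unitarymx -> chart_dom s theta U ->
    staircase_frames U <-> coord_subspace (free_rank constrained) (phi (realify U)).
  move=> Uu [lU _]; rewrite coord_subspaceP /phi enc_mxK realifyK.
  rewrite -(staircase_frames_chart theta Uu lU).
  by split=> [[]|].
have sphi : smooth_fun O phi.
  apply: smooth_fun_mx => // i j.
  set p := tnth (in_tuple (positions constrained)) j.
  have := smooth_chart_phi lam oO p.1 p.2 (fun p (Op : O p) => Op)
    (mxsmooth_complexify oO).
  by apply: smooth_ext => // q _; rewrite [RHS]mxE.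
have spsi : smooth_fun setT psi.
  apply: smooth_realify; first exact: openT.
  apply: smooth_chart_psi => //; first exact: openT.
  move=> i j; have := @smooth_entry R 'rV[R]_(size (positions constrained)) setT _ _
    id 0 (Ordinal (position_index constrained (i, j))) openT.
  move=> /(_ (fun _ _ _ => erefl) (fun _ => cvg_id)).
  by apply: smooth_ext => [|y _]; [exact: openT|rewrite [RHS]mxE].
(* The image of the chart is the whole coordinate space: [psi] sends every row vector to a unitary
   matrix in [O]. *)
clearbody phi psi O; exists O, setT, phi, psi; split; first exact: Op0.
  split.
  - by split; [exact: oO|exact: openT].
  - by move=> _ [[U Uu <-]]; rewrite OE => Ud; split; [|exact: phiK].
  - move=> x _; split; last exact: psiK.
    by split; [have [U Uu ->] := psi_u x; exists U|exact: psi_dom].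
  - by move=> p [_ Op]; exists O, phi; split.
  - by move=> x _; exists setT, psi; split=> //; exact: openT.
apply/seteqP; split=> [_ [_ [[U [Uu Us] <-] Ud] <-]|x [_ x0]].
  by split=> //; apply/phi_frames; rewrite -?OE.
exists (psi x); last exact: psiK.
split; last exact: psi_dom.
have [U Uu xU] := psi_u x; exists U; last by rewrite xU.
by apply/phi_frames; rewrite -?OE -?xU ?psiK.
Qed.

End Submanifold.

(** * The two quotients *)

(** The orthogonal columns of [A *m gram_inv A] are divided by the square roots of their squared
    norms. *)
Lemma gram_schmidt (C : numClosedFieldType) n (A : 'M[C]_n) : A \in unitmx ->
  exists T : 'M[C]_n, [/\ upper_mx T, T \in unitmx & A *m T \is unitarymx].
Proof.
move=> uA; have [QQ g0] := gram_inv_orthogonal uA.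
pose D : 'M[C]_n := diag_mx (\row_j (sqrtC (gram_inv A j j))^-1).
have s0 j : sqrtC (gram_inv A j j) != 0 by rewrite sqrtC_eq0 gt_eqF.
exists (gram_inv A *m D); split.
- exact: (mulmx_upper (gram_inv_upper A) (diag_mx_upper _)).
- rewrite unitmx_mul (gram_inv_unit uA) (upper_unitmx (diag_mx_upper _)).
  by apply/forallP => j; rewrite mxE eqxx mulr1n mxE invr_neq0.
rewrite -trmxC_unitary; apply/unitarymxP; rewrite trmxCK (mulmxA A) trmx_mul map_mxM.
rewrite mulmxA -(mulmxA (D ^t*)) QQ tr_diag_mx map_diag_mx !mulmx_diag.
apply/matrixP => i j; rewrite mxE [RHS]mxE; congr (_ *+ _).
rewrite mxE [X in X * _]mxE [X in X * _ * _]mxE [X in X^* * _ * _]mxE.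
rewrite [X in _ * X * _]mxE [X in _ * X]mxE geC0_conj ?invr_ge0 ?sqrtC_ge0 1?ltW//.
by rewrite mulrAC -invfM -expr2 sqrtCK mulVf// gt_eqF.
Qed.

(** A left eigenvector [x] corresponds to the left eigenvector [x *m invmx U] of the diagonal
    matrix; any nonzero coordinate of the latter identifies [a]. *)
Lemma eigenvalue_conj_diag (F : fieldType) n (U : 'M[F]_n) (v : 'rV[F]_n) a :
  U \in unitmx ->
  eigenvalue (invmx U *m diag_mx v *m U) a <-> exists j, a = v 0 j.
Proof.
move=> uU; split=> [/eigenvalueP[x xe x0]|[j ->]].
  have y0 : x *m invmx U != 0.
    by apply: contra x0 => /eqP y0; rewrite -(mulmxKV uU x) y0 mul0mx.
  have ye : (x *m invmx U) *m diag_mx v = a *: (x *m invmx U).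
    by rewrite scalemxAl -xe !mulmxA (mulmxK uU).
  have [j yj] : exists j, (x *m invmx U) 0 j != 0.
    apply/existsP; apply: contraR y0; rewrite negb_exists => /forallP y0.
    by apply/eqP/rowP => j; rewrite [RHS]mxE; apply/eqP; move: (y0 j); rewrite negbK.
  exists j; have := congr1 (fun z : 'rV_n => z 0 j) ye.
  rewrite mul_mx_diag [LHS]mxE [RHS]mxE mulrC => e.
  by apply/esym/(mulIf yj).
apply/eigenvalueP; exists (delta_mx 0 j *m U).
  rewrite !mulmxA (mulmxK uU) scalemxAl; congr (_ *m _).
  apply/rowP => k; rewrite mul_mx_diag !mxE eqxx/=.
  by case: eqP => [->|_]; rewrite ?mulr1 ?mul1r ?mulr0 ?mul0r.
apply/eqP => /(congr1 (mulmx^~ (invmx U))); rewrite (mulmxK uU) mul0mx.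
by move=> /rowP/(_ j); rewrite !mxE !eqxx => /eqP; rewrite oner_eq0.
Qed.

(** * Invariance under the two torus actions *)

Section Torus.
Variables (R : realType) (n : nat) (h : 'I_n -> 'I_n) (lam : 'I_n -> R).
Hypothesis hess : hessenberg_function h.

(** Diagonal matrices commute with [Lambda_mx lam], so the conjugate of the latter is unchanged. *)
Lemma left_torus_frames t U :
  @diag_torus R n t -> staircase_frames h lam U ->
  staircase_frames h lam (t *m U).
Proof.
move=> [/diag_mxP[v tE] tu] [Uu sU]; split; first exact: (mul_unitarymx tu Uu).
have uU := unitarymx_unit Uu; have ut := unitarymx_unit tu.
have tuU : t *m U \in unitmx by rewrite unitmx_mul ut.
have -> : invmx (t *m U) *m Lambda_mx lam *m (t *m U) =
    invmx U *m Lambda_mx lam *m U => //.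
apply: (can_inj (mulKmx tuU)); rewrite !mulmxA (mulmxV tuU) mul1mx (mulmxK uU).
by rewrite tE /Lambda_mx diag_mxC.
Qed.

(** The conjugate of [Lambda_mx lam] is further conjugated by [t], which is upper triangular and so
    preserves the staircase. *)
Lemma right_torus_frames t U :
  @diag_torus R n t -> staircase_frames h lam U ->
  staircase_frames h lam (U *m t).
Proof.
move=> [/diag_mxP[v tE] tu] [Uu sU]; split; first exact: (mul_unitarymx Uu tu).
have uU := unitarymx_unit Uu; have ut := unitarymx_unit tu.
have tt : upper_mx t by rewrite tE; exact: diag_mx_upper.
have uUt : U *m t \in unitmx by rewrite unitmx_mul uU.
suff -> : invmx (U *m t) *m Lambda_mx lam *m (U *m t) =
    invmx t *m (invmx U *m Lambda_mx lam *m U) *m t.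
  by apply/(low_staircase_conj hess _ ut tt).
apply: (can_inj (mulKmx uUt)); rewrite !mulmxA (mulmxV uUt) mul1mx.
by rewrite (mulmxK ut) (mulmxV uU) mul1mx.
Qed.

End Torus.

(** * The left quotient: isospectral staircase matrices *)

Section LeftQuotient.
Variables (R : realType) (n : nat) (h : 'I_n -> 'I_n) (lam : 'I_n -> R).
Hypothesis lam_inj : injective lam.

Lemma hermsymmxP (A : 'M[R[i]]_n) :
  reflect (A = A ^t*) (A \is hermsymmx).
Proof.
by apply: (iffP (is_hermitianmxP _ _ _)) => e; move: e; rewrite expr0 scale1r.
Qed.

Lemma hermitian_staircaseP (A : 'M[R[i]]_n) : A \is hermsymmx ->
  hermitian_staircase h A <-> low_staircase h A.
Proof.
move=> hA; split=> [[_ sA] i j hij|sA]; first by rewrite sA// hij orbT.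
split=> // i j /orP[hij|hij]; last exact: sA.
by have /hermsymmxP -> := hA; rewrite mxE mxE sA// conjC0.
Qed.

Lemma conj_Lambda_hermitian (U : 'M[R[i]]_n) : U \is unitarymx ->
  invmx U *m Lambda_mx lam *m U \is hermsymmx.
Proof.
move=> Uu; have LE : (Lambda_mx lam) ^t* = Lambda_mx lam.
  rewrite /Lambda_mx tr_diag_mx map_diag_mx; apply: (congr1 (@diag_mx _ _)).
  by apply/rowP => j; rewrite !mxE; exact: conjc_real.
apply/hermsymmxP; rewrite (invmx_unitary Uu) !trmx_mul !map_mxM trmxCK.
by rewrite mulmxA LE.
Qed.

(** The spectral theorem diagonalizes [A] unitarily with some diagonal [sp]. Each of the [n]
    distinct [lam j] occurs in [sp], so choosing positions gives a permutation: every eigenvalue is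
    simple, and a permutation matrix reorders [sp] into [lam]. *)
Lemma isospectral_conj (A : 'M[R[i]]_n) : isospectral lam A ->
  exists2 U, U \is unitarymx & A = invmx U *m Lambda_mx lam *m U.
Proof.
move=> [hA eA]; have nA := hermitian_normalmx hA.
have /orthomx_spectralP AE := nA.
have Pu := spectral_unitarymx A; have Pn := unitarymx_unit Pu.
set P := spectralmx A in AE Pu Pn; set sp := spectral_diag A in AE.
have spE j : exists k, sp 0 k = ((lam j)%:C)%C.
  have /(eA _).2 : exists k, ((lam j)%:C)%C = ((lam k)%:C)%C by exists j.
  by rewrite AE => /(eigenvalue_conj_diag sp _ Pn)[k ->]; exists k.
have [g gE] := choice spE.
have g_inj : injective g.
  by move=> j k e; apply/lam_inj/complexI; rewrite -!gE e.
pose s : {perm 'I_n} := ((perm g_inj)^-1)%g.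
have spL : sp = \row_j ((lam (s j))%:C)%C.
  by apply/rowP => j; rewrite mxE -gE -[g _](permE g_inj) permKV.
have e := perm_Lambda lam s; rewrite -spL in e.
pose W : 'M[R[i]]_n := perm_mx s.
have Wu : W \is unitarymx by exact: perm_mx_unitary.
have Wn := unitarymx_unit Wu.
have Wi : invmx W \is unitarymx by rewrite -perm_mx_trmxC trmxC_unitary.
exists (invmx W *m P).
  exact: (mul_unitarymx Wi Pu).
have iE : invmx (invmx W *m P) = invmx P *m W.
  have uWP : invmx W *m P \in unitmx by rewrite unitmx_mul unitmx_inv Wn.
  apply: (can_inj (mulKmx uWP)); rewrite (mulmxV uWP) -mulmxA (mulKVmx Pn).
  by rewrite (mulVmx Wn).
by rewrite iE AE -(mulmxA _ W) e !mulmxA (mulmxK Wn).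
Qed.

Lemma left_quotient_frames :
  left_ident lam @` left_quotient (staircase_frames h lam) =
  isospectral_staircase h lam.
Proof.
apply/seteqP; split=> [_ [_ [U [Uu sU] <-] <-]|A [sA iA]].
  rewrite left_identE//; have hA := conj_Lambda_hermitian Uu.
  split; first exact/hermitian_staircaseP.
  split=> // a; rewrite (eigenvalue_conj_diag _ _ (unitarymx_unit Uu)).
  by split=> -[j ->]; exists j; rewrite mxE.
have [U Uu AE] := isospectral_conj iA.
have frU : staircase_frames h lam U.
  by split=> //; rewrite -AE; apply/hermitian_staircaseP => //; exact: iA.1.
exists (left_class U); first by exists U.
by rewrite left_identE.
Qed.

End LeftQuotient.

(** * The right quotient: the Hessenberg variety *)

Section RightQuotient.
Variables (R : realType) (n : nat).
Implicit Types U T : 'M[R[i]]_n.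

Lemma mulmx_col m p q (A : 'M[R[i]]_(m, p)) (B : 'M[R[i]]_(p, q)) j :
  col j (A *m B) = A *m col j B.
Proof. by rewrite !colE mulmxA. Qed.

Lemma col_mulmx_sum m p (A : 'M[R[i]]_(m, n)) (B : 'M[R[i]]_(n, p)) j :
  col j (A *m B) = \sum_k B k j *: col k A.
Proof.
apply/colP => a; rewrite mxE mxE summxE; apply: eq_bigr => k _.
by rewrite !mxE mulrC.
Qed.

Lemma col_in_flag U (i : 'I_n.+1) (j : 'I_n) : (j < i)%N ->
  col j U \in column_flag U i.
Proof.
move=> ji; rewrite ffunE; apply: memv_span; apply: map_f.
by rewrite mem_filter ji mem_enum.
Qed.

Lemma column_flag_subP U (i : 'I_n.+1) (W : {vspace 'cV[R[i]]_n}) :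
  (forall j : 'I_n, (j < i)%N -> col j U \in W) -> (column_flag U i <= W)%VS.
Proof.
move=> h; rewrite ffunE; apply/span_subvP => _ /mapP[j + ->].
by rewrite mem_filter => /andP[ji _]; exact: h.
Qed.

(** Each column of [U *m T] combines columns of [U] of no larger index; the reverse inclusion
    applies this to [U *m T] and [invmx T]. *)
Lemma column_flag_upper U T : upper_mx T -> T \in unitmx ->
  column_flag (U *m T) = column_flag U.
Proof.
have sub (A B : 'M[R[i]]_n) i : upper_mx B ->
    (column_flag (A *m B) i <= column_flag A i)%VS.
  move=> /upper_mxP uB; apply: column_flag_subP => j ji.
  rewrite col_mulmx_sum memv_suml// => k _; have [kj|jk] := leqP k j.
    by rewrite memvZ// col_in_flag// (leq_ltn_trans kj).
  by rewrite uB// scale0r mem0v.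
move=> uT TU; apply/ffunP => i; apply/eqP; rewrite eqEsubv sub//=.
by rewrite -{1}(mulmxK TU U) sub//; exact: invmx_upper.
Qed.

Lemma column_flag_coord U (i : 'I_n.+1) v (k : 'I_n) : U \in unitmx ->
  v \in column_flag U i -> (i <= k)%N -> (invmx U *m v) k 0 = 0.
Proof.
(* [M] extracts the [k]-th coordinate in the basis of columns of [U]; its kernel is a subspace, so
   only the spanning columns need be tested. *)
move=> uU vi ik; pose M : 'M[R[i]]_n := delta_mx k k *m invmx U.
have : (column_flag U i <= lker (linfun (mulmx M)))%VS.
  apply: column_flag_subP => j ji; rewrite memv_ker lfunE/=.
  rewrite -mulmx_col -mulmxA (mulVmx uU) mulmx1; apply/eqP/colP => a.
  rewrite !mxE -[j == k]val_eqE/= ltn_eqF ?andbF//.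
  exact: leq_trans ji ik.
move=> /subvP/(_ _ vi); rewrite memv_ker lfunE/= /M -mulmxA => /eqP.
move=> /colP/(_ k); rewrite [RHS]mxE mxE (bigD1 k)//= big1 ?addr0 => [|a ak].
  by rewrite mxE !eqxx mul1r.
by rewrite mxE (negbTE ak) andbF mul0r.
Qed.

Lemma size_enum_lt (i : nat) : (i <= n)%N ->
  size [seq j : 'I_n <- enum 'I_n | (j < i)%N] = i.
Proof.
move=> ilen; rewrite size_filter -(count_map val (fun k => (k < i)%N)).
rewrite val_enum_ord -size_filter (@filter_iota_ltn 0 n i ilen).
exact: size_iota.
Qed.

Lemma columns_free U : U \in unitmx -> free [seq col j U | j <- enum 'I_n].
Proof.
move=> uU.
have -> : [seq col j U | j <- enum 'I_n] = [tuple col j U | j < n] :> seq _ by [].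
apply/freeP => c c0 j.
have : U *m (\col_j c j) = 0.
  apply/colP => a; rewrite [RHS]mxE mxE.
  transitivity ((\sum_(b < n) c b *: [tuple col j U | j < n]`_b) a 0); last first.
    by rewrite c0 mxE.
  rewrite summxE; apply: eq_bigr => b _.
  by rewrite (nth_map b) ?size_enum_ord// nth_ord_enum !mxE mulrC.
move=> /(congr1 (mulmx (invmx U))); rewrite (mulKmx uU) mulmx0.
by move=> /colP/(_ j); rewrite !mxE.
Qed.

Lemma dim_column_flag U (i : 'I_n.+1) : U \in unitmx ->
  \dim (column_flag U i) = i.
Proof.
move=> uU; rewrite ffunE.
have fr : free [seq col j U | j : 'I_n <- enum 'I_n & (j < i)%N].
  have := columns_free uU.
  have pe := perm_map (fun j => col j U)
    (permEl (perm_filterC (fun j : 'I_n => (j < i)%N) (enum 'I_n))).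
  by rewrite -(perm_free pe) map_cat => /catl_free.
rewrite (eqP fr) size_map size_enum_lt//.
by rewrite -ltnS ltn_ord.
Qed.

Lemma column_flag_complete U : U \in unitmx -> complete_flags (column_flag U).
Proof.
move=> uU; split=> [i j ij|i]; last exact: dim_column_flag.
by apply: column_flag_subP => k ki; apply: col_in_flag; exact: leq_trans ij.
Qed.

(** Column [j] is chosen in the term of dimension [j.+1] outside the term of dimension [j]. The
    spans of the first columns then grow strictly inside [V], and dimensions force equality. *)
Lemma complete_flag_columns V : complete_flags V ->
  exists2 B : 'M[R[i]]_n, B \in unitmx & column_flag B = V.
Proof.
move=> [Vmono Vdim].
(* [lo j] has value [j] while [lift ord0 j] has value [j.+1]: consecutive terms of the flag. *)
pose lo (j : 'I_n) : 'I_n.+1 := widen_ord (leqnSn n) j.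
have vE (j : 'I_n) : exists v, v \in V (lift ord0 j) /\ v \notin V (lo j).
  have /subvPn[v v1 v2] : ~~ (V (lift ord0 j) <= V (lo j))%VS.
    by apply/negP => /dimvS; rewrite !Vdim lift0/= ltnn.
  by exists v.
have [v vP] := choice vE.
pose B : 'M[R[i]]_n := \matrix_(a, j) v j a 0.
have colB j : col j B = v j by apply/colP => a; rewrite !mxE.
have sub i : (column_flag B i <= V i)%VS.
  apply: column_flag_subP => j ji; rewrite colB.
  by have [+ _] := vP j; apply/subvP/Vmono; rewrite lift0.
have eqV i : column_flag B i = V i.
  apply/eqP; case: i => i; elim: i => [|i IH] isn.
    by rewrite eqEdim sub Vdim.
  have ilt : (i < n.+1)%N by exact: ltn_trans isn.
  pose j : 'I_n := Ordinal (isn : (i < n)%N).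
  have loE : lo j = Ordinal ilt by exact: val_inj.
  have liE : lift ord0 j = Ordinal isn by exact: val_inj.
  have dI : \dim (column_flag B (Ordinal ilt)) = i by rewrite (eqP (IH ilt)) Vdim.
  rewrite eqEdim sub Vdim/=.
  suff : (\dim (column_flag B (Ordinal ilt)) <
      \dim (column_flag B (Ordinal isn)))%N by rewrite dI.
  rewrite ltnNge; apply/negP => le_dim.
  have : column_flag B (Ordinal ilt) == column_flag B (Ordinal isn).
    rewrite eqEdim le_dim andbT; apply: column_flag_subP => k ki.
    by apply: col_in_flag; exact: ltn_trans ki _.
  move=> /eqP e; have [_ /negP] := vP j; apply.
  by rewrite loE -(eqP (IH ilt)) e -colB; apply: col_in_flag.
exists B; last by apply/ffunP.
have fr : free [tuple col j B | j < n].
  have {}eqV := eqV ord_max; rewrite ffunE in eqV.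
  have all_lt : [seq j : 'I_n <- enum 'I_n | (j < @ord_max n)%N] = enum 'I_n.
    by apply/all_filterP/allP => j _ /=.
  rewrite all_lt in eqV; rewrite /free size_tuple.
  have dn : \dim (V ord_max) = n by rewrite Vdim.
  by apply/eqP; rewrite -[RHS]dn -eqV.
rewrite -unitmx_tr -row_free_unit -kermx_eq0; apply/rowV0P => y.
move=> /sub_kermxP/(congr1 trmx); rewrite trmx_mul trmxK trmx0 => By0.
apply/rowP => j; rewrite [RHS]mxE; move/freeP: fr; apply.
apply/colP => a; transitivity ((B *m y^T) a 0); last by rewrite By0.
rewrite summxE [RHS]mxE; apply: eq_bigr => b _.
by rewrite (nth_map b) ?size_enum_ord// nth_ord_enum !mxE mulrC.
Qed.

(** The entries of the conjugated matrix are the coordinates of the images of the columns, which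
    links the staircase to the Hessenberg condition. *)
Lemma Lambda_column h lam U : staircase_frames h lam U ->
  forall j, Lambda_mx lam *m col j U =
    \sum_k (invmx U *m Lambda_mx lam *m U) k j *: col k U.
Proof.
move=> [Uu _] j; rewrite -col_mulmx_sum -!mulmxA (mulKVmx (unitarymx_unit Uu)).
by rewrite mulmx_col.
Qed.

Lemma right_quotient_frames h lam : hessenberg_function h ->
  @right_ident R n @` right_quotient (staircase_frames h lam) =
  hessenberg_variety h lam.
Proof.
move=> hess; apply/seteqP; split=> [_ [_ [U frU <-] <-]|V [Vc Vh]].
  rewrite right_identE; have [Uu sU] := frU; have uU := unitarymx_unit Uu.
  split; first exact: column_flag_complete.
  move=> i v vi.
  have : (column_flag U (lift ord0 i) <= linfun (mulmx (Lambda_mx lam)) @^-1: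
      column_flag U (lift ord0 (h i)))%VS.
    apply: column_flag_subP => j; rewrite lift0 ltnS => ji.
    rewrite -memv_preim lfunE/= (Lambda_column frU) memv_suml// => k _.
    have [kh|hk] := leqP k (h j).
      rewrite memvZ// col_in_flag// lift0 ltnS (leq_trans kh)//.
      exact: hessenberg_mono.
    by rewrite sU// scale0r mem0v.
  by move=> /subvP/(_ _ vi); rewrite -memv_preim lfunE.
(* A basis adapted to the flag is made unitary by an upper triangular change of basis, which keeps
   the flag. *)
have [B uB BV] := complete_flag_columns Vc.
have [T [tT uT Uu]] := gram_schmidt uB.
have UV : column_flag (B *m T) = V by rewrite column_flag_upper.
exists (right_class (B *m T)); last by rewrite right_identE.
exists (B *m T) => //; split=> // i j hji.
(* The image of column [j] lies in the span of the columns of index at most [h j], so its coordinate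
   [i > h j], an entry below the staircase, is zero. *)
have := Vh j (col j (B *m T)); rewrite -UV => /(_ (col_in_flag _ _)).
rewrite lift0 => /(_ (ltnSn j)) inV.
have := column_flag_coord (unitarymx_unit Uu) inV (k := i).
rewrite lift0 => /(_ hji) <-.
by rewrite [in RHS](mulmxA (invmx _)) -mulmx_col [RHS]mxE.
Qed.

End RightQuotient.

Theorem theorem1 (R : realType) (n : nat) (h : 'I_n -> 'I_n)
    (lam : 'I_n -> R) :
  hessenberg_function h ->
  (forall i j : 'I_n, (i < j)%N -> lam i < lam j) ->
  exists Z : set 'M[R[i]]_n,
    [/\ smooth_mx_submanifold (@unitary_group R n) Z,
        (forall t U, @diag_torus R n t -> Z U -> Z (t *m U)),
        (forall t U, @diag_torus R n t -> Z U -> Z (U *m t)),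
        left_ident lam @` left_quotient Z = isospectral_staircase h lam &
        @right_ident R n @` right_quotient Z = hessenberg_variety h lam].
Proof.
move=> hess lam_mono; have lam_inj : injective lam.
  move=> i j e; apply: val_inj; case: (ltngtP (val i) (val j)) => // /lam_mono;
  by rewrite e ltxx.
exists (staircase_frames h lam); split.
- exact: staircase_frames_submanifold.
- exact: left_torus_frames.
- exact: right_torus_frames.
- exact: left_quotient_frames.
- exact: right_quotient_frames.
Qed.
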